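(* Let $\Omega,\Omega_j\subseteq\mathbb R^n$ ($n\geq 2$) be nonempty open bounded sets for all $j\in\mathbb N$. If $\chi_{\Omega_j}\to\chi_\Omega$ in $L^1$ as $j\to\infty$, then $$\liminf_{j\to\infty} h(\Omega_j)\ge h(\Omega).$$ If in addition $\Omega,\Omega_j$ are sets of finite perimeter and $P(\Omega_j)\to P(\Omega)$ as $j\to\infty$, then $$\lim_{j\to\infty}h(\Omega_j)=h(\Omega).$$
   Context: For a Borel set $F\subseteq\mathbb R^n$, $\chi_F$ is its characteristic function, $|F|$ its Lebesgue measure, and $P(F)=\sup\{\int_F \mathrm{div}\,g:\ g\in C^1_c(\mathbb R^n;\mathbb R^n),\ |g|\le 1\}$ its perimeter; $F$ has finite perimeter if $P(F)<+\infty$. For a bounded open set $\Omega$ the Cheeger constant is $h(\Omega)=\inf\{P(F)/|F|:\ F\subseteq\Omega,\ |F|>0\}$. *)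

(* Defs.v *)
From HB Require Import structures.
From mathcomp Require Import all_boot all_order all_algebra.
From mathcomp Require Import all_classical all_reals all_analysis.
From mathcomp Require Import measurable_realfun.

Set Implicit Arguments.
Unset Strict Implicit.
Unset Printing Implicit Defensive.

Import Order.TTheory GRing.Theory Num.Theory.
Import numFieldNormedType.Exports.

Local Open Scope classical_set_scope.
Local Open Scope ring_scope.

(* R^n is 'rV[R]_n, and its measurable sets are the Borel sets. *)
Section borel_rV.
Context {R : realType} {n : nat}.

HB.instance Definition _ := @isMeasurable.Build
  (sigma_display (@open 'rV[R]_n)) 'rV[R]_n
  <<s @open 'rV[R]_n >> (@sigma_algebra0 _ setT _) (@sigma_algebraC _ _)
  (@sigma_algebra_bigcup _ setT _).

Lemma open_measurable_rV (U : set 'rV[R]_n) : open U -> measurable U.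
Proof. by move=> oU; apply: sub_sigma_algebra. Qed.

Lemma open_rV_bigcup_ball (U : set 'rV[R]_n) : open U ->
  U = \bigcup_(p in [set p : 'rV[rat]_n * nat |
         ball (map_mx ratr p.1 : 'rV[R]_n) p.2.+1%:R^-1 `<=` U])
       ball (map_mx ratr p.1 : 'rV[R]_n) p.2.+1%:R^-1.
Proof.
move=> oU; apply/seteqP; split => [x Ux|x [p pU]]; last exact: pU.
have /nbhs_ballP[e /= e0 xeU] : nbhs x U by apply: open_nbhs_nbhs.
have e20 : 0 < e / 2 by rewrite divr_gt0.
have [k /= ke] : exists k : nat, k.+1%:R^-1 < e / 2 :> R.
  by exists (Num.trunc (e / 2)^-1); rewrite invf_plt ?posrE// truncnS_gt.
have k0 : 0 < k.+1%:R^-1 :> R by rewrite invr_gt0.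
have qP i : exists q : rat,
    x ord0 i - k.+1%:R^-1 < ratr q < x ord0 i + k.+1%:R^-1.
  have [|q] := @rat_in_itvoo R (x ord0 i - k.+1%:R^-1) (x ord0 i + k.+1%:R^-1).
    by rewrite ltrD2l gt0_cp.
  by rewrite in_itv/= => ?; exists q.
pose q := \row_i projT1 (cid (qP i)).
have xq : ball (map_mx ratr q : 'rV[R]_n) k.+1%:R^-1 x.
  split=> // i j; rewrite (ord1 i) !mxE/= /ball/= distrC ltr_distlC.
  by case: cid => ? /= /andP[-> ?].
exists (q, k) => //= y qy; apply: xeU; rewrite /= (splitr e).
apply: (@ball_triangle _ _ (map_mx ratr q : 'rV[R]_n)).
  by apply: ball_sym; apply: le_ball xq; exact: ltW.
by apply: le_ball qy; exact: ltW.
Qed.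

Lemma measurable_coord_rV (i : 'I_n) :
  measurable_fun setT (fun v : 'rV[R]_n => v ord0 i : measurableTypeR R).
Proof.
apply: (measurability _ (RGenOpens.measurableE R)).
move=> _ [_ [a [b ->]] <-]; rewrite setTI; apply: open_measurable_rV.
apply: open_comp => [v _|]; first exact: coord_continuous.
exact: interval_open.
Qed.

Lemma measurable_fun_rV d (T : measurableType d) (f : T -> 'rV[R]_n) :
  (forall i, measurable_fun setT (fun t => f t ord0 i : measurableTypeR R)) ->
  measurable_fun setT f.
Proof.
move=> mf; apply: (@measurability _ _ T 'rV[R]_n _ _ (@open 'rV[R]_n)) => //.
move=> _ [U oU <-]; rewrite setTI (open_rV_bigcup_ball oU) bigcup_mkcond.
rewrite preimage_bigcup; apply: countable_bigcupT_measurable => // p.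
case: ifPn => _; last by rewrite preimage_set0.
rewrite (_ : _ @^-1` _ = \bigcap_(i in [set: 'I_n])
    (fun t => f t ord0 i) @^-1` ball (ratr (p.1 ord0 i) : R) p.2.+1%:R^-1).
  apply: fin_bigcap_measurable => // i _; rewrite -[X in measurable X]setTI.
  apply: mf => //; rewrite /= ball_itv; exact: measurable_itv.
apply/seteqP; split => [t [_ pt] i _|t pt]/=.
  by have := pt ord0 i; rewrite mxE.
by split=> [|i j]; [rewrite invr_gt0|rewrite (ord1 i) mxE; exact: pt].
Qed.

End borel_rV.

(* Lebesgue measure on R^(n+1) is the image of the product of Lebesgue measure
   on R and Lebesgue measure on R^n. *)
Section lebesgue_rV_step.
Context {R : realType} {n : nat}.

Definition rV_cons (p : measurableTypeR R * 'rV[R]_n) : 'rV[R]_n.+1 :=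
  row_mx (p.1 : R)%:M p.2.

Definition rV_uncons (v : 'rV[R]_n.+1) : measurableTypeR R * 'rV[R]_n :=
  (v ord0 ord0, \row_i v ord0 (lift ord0 i)).

Lemma rV_cons0 p : rV_cons p ord0 ord0 = p.1.
Proof.
rewrite /rV_cons (_ : ord0 = lshift n (ord0 : 'I_1)); last exact/val_inj.
by rewrite [LHS]row_mxEl mxE eqxx.
Qed.

Lemma rV_cons_lift p i : rV_cons p ord0 (lift ord0 i) = p.2 ord0 i.
Proof.
rewrite /rV_cons (_ : lift ord0 i = rshift 1 i); last exact/val_inj.
exact: row_mxEr.
Qed.

Lemma rV_consK : cancel rV_cons rV_uncons.
Proof.
move=> p; rewrite /rV_uncons rV_cons0 [RHS]surjective_pairing; congr pair.
by apply/rowP => i; rewrite mxE rV_cons_lift.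
Qed.

Lemma rV_unconsK : cancel rV_uncons rV_cons.
Proof.
move=> v; apply/rowP => i; have [j ->|->] := unliftP ord0 i.
  by rewrite rV_cons_lift mxE.
by rewrite rV_cons0.
Qed.

Lemma measurable_rV_cons : measurable_fun setT rV_cons.
Proof.
apply: measurable_fun_rV => i; have [j ->|->] := unliftP ord0 i.
  under eq_fun do rewrite rV_cons_lift.
  apply: (measurableT_comp (measurable_coord_rV j)); exact: measurable_snd.
under eq_fun do rewrite rV_cons0.
exact: measurable_fst.
Qed.

Lemma measurable_rV_uncons : measurable_fun setT rV_uncons.
Proof.
apply/measurable_fun_pairP; split; first exact: measurable_coord_rV.
apply: measurable_fun_rV => i /=; under eq_fun do rewrite mxE.
exact: measurable_coord_rV.
Qed.

Variable m : {sigma_finite_measure set 'rV[R]_n -> \bar R}.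

Definition lebesgue_rV_step : set 'rV[R]_n.+1 -> \bar R :=
  pushforward (@lebesgue_measure R \x m)%E rV_cons.

Let step0 : lebesgue_rV_step set0 = 0%E.
Proof. by rewrite /lebesgue_rV_step /pushforward preimage_set0 measure0. Qed.

Let step_ge0 A : (0 <= lebesgue_rV_step A)%E.
Proof. exact: integral_ge0. Qed.

Let step_sigma_additive : semi_sigma_additive lebesgue_rV_step.
Proof.
move=> F mF tF mUF; rewrite /lebesgue_rV_step.
by apply: measure_semi_sigma_additive => //; exact: measurable_rV_cons.
Qed.

HB.instance Definition _ := isMeasure.Build _ _ _ lebesgue_rV_step
  step0 step_ge0 step_sigma_additive.

Let step_sigma_finite : sigma_finite setT lebesgue_rV_step.
Proof.
have /sigma_finiteP[F [TF ndF Foo]] := sigma_finiteT (@lebesgue_measure R).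
have /sigma_finiteP[G [TG ndG Goo]] := sigma_finiteT m.
exists (fun k => rV_uncons @^-1` (F k `*` G k)).
  rewrite -preimage_bigcup -[LHS](preimage_setT rV_uncons); congr preimage.
  apply/seteqP; split => [[x y] _|//].
  have : setT x by []; rewrite {1}TF => -[k _ Fkx].
  have : setT y by []; rewrite {1}TG => -[l _ Gly].
  exists (maxn k l) => //; split => /=.
    by move: (x) Fkx; exact/subsetPset/ndF/leq_maxl.
  by move: (y) Gly; exact/subsetPset/ndG/leq_maxr.
move=> k; have [mF Fk] := Foo k; have [mG Gk] := Goo k; split.
  rewrite -[X in measurable X]setTI; apply: measurable_rV_uncons => //.
  exact: measurableX.
rewrite /lebesgue_rV_step /pushforward -comp_preimage.
rewrite (_ : rV_uncons \o rV_cons = id) ?preimage_id; last first.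
  by apply/funext => p /=; rewrite rV_consK.
by rewrite product_measure1E// lte_mul_pinfty// ge0_fin_numE.
Qed.

HB.instance Definition _ := Measure_isSigmaFinite.Build _ _ _ lebesgue_rV_step
  step_sigma_finite.

End lebesgue_rV_step.

Fixpoint lebesgue_rV {R : realType} (n : nat) :
    {sigma_finite_measure set 'rV[R]_n -> \bar R} :=
  if n is n'.+1 then lebesgue_rV_step (lebesgue_rV n')
  else \d_(0 : 'rV[R]_0).

Lemma lebesgue_rV_box {R : realType} (n : nat) (a b : 'rV[R]_n) :
  (forall i, a ord0 i <= b ord0 i) ->
  lebesgue_rV n [set v : 'rV[R]_n | forall i, a ord0 i <= v ord0 i <= b ord0 i]
  = (\prod_(i < n) (b ord0 i - a ord0 i))%:E.
Proof.
elim: n a b => [|n IHn] a b ab.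
  by rewrite big_ord0 /= diracE mem_set//= => -[].
pose a' := (rV_uncons a).2; pose b' := (rV_uncons b).2.
have mB : measurable [set v : 'rV[R]_n |
    forall i, a' ord0 i <= v ord0 i <= b' ord0 i].
  rewrite (_ : mkset _ = \bigcap_(i in [set: 'I_n])
      (fun v : 'rV[R]_n => v ord0 i) @^-1` `[a' ord0 i, b' ord0 i]).
    apply: fin_bigcap_measurable => // i _; rewrite -[X in measurable X]setTI.
    exact: measurable_coord_rV.
  by apply/seteqP; split => [v h i _|v h i]; have /= := h i;
    rewrite in_itv//=; apply.
rewrite big_ord_recl.
rewrite -[LHS]/((lebesgue_measure \x lebesgue_rV n)%E (rV_cons @^-1` _)).
rewrite (_ : rV_cons @^-1` _ = `[a ord0 ord0, b ord0 ord0] `*`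
    [set v : 'rV[R]_n | forall i, a' ord0 i <= v ord0 i <= b' ord0 i]).
  rewrite product_measure1E//.
  rewrite [X in (X * _)%E]lebesgue_measure_itv/= IHn.
    rewrite EFinM; congr (_ * _)%E.
      rewrite lte_fin; have := ab ord0; rewrite le_eqVlt => /predU1P[->|->].
        by rewrite ltxx subrr.
      by rewrite EFinB.
    by congr EFin; apply: eq_bigr => i _; rewrite !mxE.
  by move=> i; rewrite !mxE.
apply/seteqP; split => [p h|p [/= h1 h2] i].
  split; first by have := h ord0; rewrite rV_cons0 /= in_itv.
  by move=> i; have := h (lift ord0 i); rewrite rV_cons_lift !mxE.
have [j ->|->] := unliftP ord0 i.
  by have := h2 j; rewrite rV_cons_lift !mxE.
by move: h1; rewrite rV_cons0 in_itv.
Qed.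

Section cheeger.
Context {R : realType} {n : nat}.
Implicit Types (f : 'rV[R]_n -> R) (g : 'rV[R]_n -> 'rV[R]_n).
Implicit Types (F Omega : set 'rV[R]_n).

(* The library norm on 'rV[R]_n is the sup norm. *)
Definition eucl_norm (v : 'rV[R]_n) : R :=
  Num.sqrt (\sum_(i < n) v ord0 i ^+ 2).

Definition C1 f : Prop := forall i : 'I_n,
  (forall x, derivable f x (delta_mx ord0 i)) /\
  continuous (fun x => 'D_(delta_mx ord0 i) f x).

Definition C1c_field g : Prop :=
  (forall i : 'I_n, C1 (fun x => g x ord0 i)) /\
  compact (closure [set x | g x != 0]).

Definition divergence g (x : 'rV[R]_n) : R :=
  \sum_(i < n) 'D_(delta_mx ord0 i) (fun y => g y ord0 i) x.

Definition perimeter F : \bar R :=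
  ereal_sup [set (\int[lebesgue_rV n]_(x in F) (divergence g x)%:E)%E | g in
    [set g | C1c_field g /\ forall x, eucl_norm (g x) <= 1]].

Definition finite_perimeter F : Prop := (perimeter F < +oo)%E.

Definition cheeger_constant Omega : \bar R :=
  ereal_inf [set (perimeter F / lebesgue_rV n F)%E | F in
    [set F | [/\ measurable F, F `<=` Omega & (0 < lebesgue_rV n F)%E]]].

End cheeger.

(* Main.v *)
From HB Require Import structures.
Require Import Defs.
From mathcomp Require Import all_boot all_order all_algebra.
From mathcomp Require Import all_classical all_reals all_analysis.
From mathcomp Require Import measurable_realfun ring lra.
Import Order.TTheory GRing.Theory Num.Theory.
Import numFieldNormedType.Exports.
Local Open Scope classical_set_scope.
Local Open Scope ring_scope.

Set Implicit Arguments.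
Unset Strict Implicit.
Unset Printing Implicit Defensive.

(** Lower semicontinuity is the direct method. Let l be any real number above
    the lower limit of h(Omega_j). Along a subsequence, Omega_j has a subset
    F_j of positive volume with P(F_j) <= l |F_j|. The perimeters of these sets are bounded, and the volume of the
    part of F_j outside Omega tends to 0, so that the F_j accumulate in L1 at a set E contained in Omega (compactness). The volumes |F_j| are
    bounded below (lower_mass), hence |E| > 0, and the perimeter is lower
    semicontinuous for the L1 distance (perimeter_bound_lim), hence
    P(E) <= l |E| and h(Omega) <= l.

    For the second claim, take a competitor F for Omega and use F cap Omega_j
    as a competitor for Omega_j. Submodularity of the perimeter
    (submodular_test) gives
      P(F cap Omega_j) <= P(F) + P(Omega_j) - P(F cup Omega_j).
    As F cup Omega_j tends to Omega in L1, semicontinuity and the convergence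
    of P(Omega_j) to P(Omega) bound the upper limit of the right-hand side by
    P(F), while the volume of F cap Omega_j tends to that of F.

    All facts about the perimeter rest on one estimate (translation_estimate):
    translating E by z changes it in L1 by at most n |z| P(E), with the sup
    norm of z. Indeed, for a test function phi the integral of phi (y - x) over
    E is a C1 function of x, whose partial derivatives are bounded by P(E)
    because they are integrals over E of divergences of test fields. Averaging
    over z, the indicator of E is at L1 distance at most n e P(E) from its
    mollification at the scale e. The mollified indicators are Lipschitz, with
    a constant that depends only on e and on the volume; this gives
    compactness by an Arzela-Ascoli argument. They are also at most a constant
    times |E|; this gives the lower bound on the volume. Finally, mollifying
    does not increase the perimeter, and submodularity is transparent for
    smooth functions, where a smooth minimum and a smooth maximum of u and v
    have as gradients complementary convex combinations of the gradients of u
    and v. *)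

(** * Differential calculus of C1 functions *)

Section C1_calculus.
Context {R : realType} {n : nat}.
Implicit Types (f g : 'rV[R]_n -> R) (x y v : 'rV[R]_n).

Lemma coord_le_norm x i : `|x ord0 i| <= `|x|.
Proof.
rewrite [leRHS]/Num.Def.normr /= mx_normrE; apply/bigmax_geP; right => /=.
by exists (ord0, i).
Qed.

Lemma norm_le_coord x e : 0 <= e -> (forall i, `|x ord0 i| <= e) -> `|x| <= e.
Proof.
move=> e0 xe; rewrite [leLHS]/Num.Def.normr /= mx_normrE; apply/bigmax_leP; split => //=.
by move=> [i j] _ /=; rewrite ord1.
Qed.

Lemma sum_coord_le_norm x : \sum_(i < n) `|x ord0 i| <= n%:R * `|x|.
Proof.
rewrite mulr_natl -[X in _ *+ X]card_ord -sumr_const.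
by apply: ler_sum => i _; exact: coord_le_norm.
Qed.

Lemma is_derive_line f v x (s : R) : derivable f (s *: v + x) v ->
  is_derive s 1 (fun t : R => f (t *: v + x)) ('D_v f (s *: v + x)).
Proof.
move=> df.
have E : (fun h : R => h^-1 *: (f ((h *: 1 + s) *: v + x) - f (s *: v + x)))
       = (fun h : R => h^-1 *: (f (h *: v + (s *: v + x)) - f (s *: v + x))).
  by apply/funext => h; rewrite (_ : h *: 1 = h) ?scalerDl ?addrA//; exact: mulr1.
by apply: DeriveDef; rewrite /derivable /derive E.
Qed.

Lemma line_lipschitz f v x (t K : R) :
  (forall s : R, `|s| <= `|t| -> derivable f (s *: v + x) v) ->
  (forall s : R, `|s| <= `|t| -> `|'D_v f (s *: v + x)| <= K) ->
  `|f (t *: v + x) - f x| <= K * `|t|.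
Proof.
move=> df Kf.
pose g := fun t : R => f (t *: v + x).
have -> : f x = g 0 by rewrite /g scale0r add0r.
rewrite -/(g t).
have gd (s : R) : `|s| <= `|t| -> is_derive s 1 g ('D_v f (s *: v + x)).
  by move=> st; apply: is_derive_line; exact: df.
have gc (a b : R) : (forall s : R, a <= s <= b -> `|s| <= `|t|) ->
    {within `[a, b], continuous g}.
  move=> ab; apply: derivable_within_continuous => s; rewrite in_itv/= => sab.
  exact: (@ex_derive _ _ _ _ _ _ _ (gd _ (ab _ sab))).
have [t0|t0] := leP 0 t.
  have H (s : R) : 0 <= s <= t -> `|s| <= `|t|.
    by move=> /andP[s0 st]; rewrite !ger0_norm.
  have gd' (s : R) : s \in `]0, t[ -> is_derive s 1 g ('D_v f (s *: v + x)).
    by rewrite in_itv/= => /andP[/ltW s0 /ltW st]; apply/gd/H/andP.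
  have [c] := MVT_segment t0 gd' (gc _ _ H).
  rewrite in_itv/= => /H cb ->; rewrite subr0 normrM.
  by rewrite ler_wpM2r//; exact: Kf.
have H (s : R) : t <= s <= 0 -> `|s| <= `|t|.
  by move=> /andP[s0 st]; rewrite !ler0_norm ?lerN2// ltW.
have gd' (s : R) : s \in `]t, 0[ -> is_derive s 1 g ('D_v f (s *: v + x)).
  by rewrite in_itv/= => /andP[/ltW s0 /ltW st]; apply/gd/H/andP.
have [c] := MVT_segment (ltW t0) gd' (gc _ _ H).
rewrite in_itv/= => /H cb; rewrite distrC => ->; rewrite sub0r normrM normrN.
by rewrite ler_wpM2r//; exact: Kf.
Qed.

(** Go from x to y one coordinate at a time and apply the mean value theorem
    on each segment: this path stays in the box over which the partial
    derivatives are bounded. *)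
Lemma C1_lipschitz_near f (x y : 'rV[R]_n) K : C1 f ->
  (forall (z : 'rV[R]_n) i, (forall j, `|z ord0 j - x ord0 j| <= `|y ord0 j - x ord0 j|) ->
    `|'D_(delta_mx ord0 i) f z| <= K) ->
  `|f y - f x| <= K * \sum_(i < n) `|y ord0 i - x ord0 i|.
Proof.
move=> f1 Kf.
(* The point whose first k coordinates are those of y and the others those of x. *)
pose z (k : nat) : 'rV[R]_n :=
  \row_i if (i < k)%N then y ord0 i else x ord0 i.
have z0 : z 0%N = x by apply/rowP => i; rewrite mxE.
have zn : z n = y by apply/rowP => i; rewrite mxE ltn_ord.
rewrite -[in f y]zn -[in f x]z0 -(telescope_sumr (fun k => f (z k)) (leq0n n)).
rewrite mulr_sumr big_mkord; apply: le_trans (ler_norm_sum _ _ _) _.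
apply: ler_sum => k _.
set t := y ord0 k - x ord0 k.
have -> : z k.+1 = t *: delta_mx ord0 k + z k.
  apply/rowP => j; rewrite !mxE eqxx /= ltnS leq_eqVlt.
  have [->|/= jk] := eqVneq j k.
    by rewrite eqxx ltnn /= mulr1 subrK.
  by rewrite (negbTE (_ : j != k :> nat))// mulr0 add0r.
apply: line_lipschitz => s st; first by have [] := f1 k.
apply: Kf => j; rewrite !mxE eqxx /=.
have [->|jk] := eqVneq j k; first by rewrite mulr1 ltnn addrK.
by rewrite mulr0 add0r; case: ifP => // _; rewrite subrr normr0.
Qed.

Lemma C1_lipschitz f K : C1 f ->
  (forall (z : 'rV[R]_n) i, `|'D_(delta_mx ord0 i) f z| <= K) ->
  forall x y, `|f y - f x| <= K * n%:R * `|y - x|.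
Proof.
move=> f1 Kf x y.
have [n0|n0] := posnP n.
  have -> : y = x by apply/rowP => -[i ni]; exfalso; rewrite n0 in ni.
  by rewrite !subrr !normr0 mulr0.
have K0 : 0 <= K by apply: le_trans (Kf 0 (Ordinal n0)).
apply: le_trans (C1_lipschitz_near f1 (fun z i _ => Kf z i)) _.
rewrite -mulrA ler_wpM2l//; apply: le_trans (sum_coord_le_norm (y - x)).
by apply: ler_sum => i _; rewrite !mxE.
Qed.

(** Continuous partial derivatives are locally bounded, so the estimate above
    applies in a ball around every point. *)
Lemma C1_continuous f : C1 f -> continuous f.
Proof.
move=> f1 x.
have [M [M0 HM]] : exists M, 0 < M /\
    \forall z \near x, forall i, `|'D_(delta_mx ord0 i) f z| <= M.
  pose b i := `|'D_(delta_mx ord0 i) f x| + 1.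
  exists (1 + \sum_i b i); split.
    by rewrite ltr_pwDl// sumr_ge0// => i _; rewrite addr_ge0.
  apply: (@filter_forall _ 'I_n
    (fun i z => `|'D_(delta_mx ord0 i) f z| <= 1 + \sum_i b i) (nbhs x)) => i.
  have [_ /(_ x)/cvgr_norm_lt] := f1 i.
  move=> /(_ (b i)); rewrite ltrDl => /(_ ltr01); apply: filterS => z /ltW.
  move=> /le_trans; apply.
  rewrite (bigD1 i)//= addrCA lerDl addr_ge0// sumr_ge0// => j _.
  by rewrite addr_ge0.
have /nbhs_ballP[r /= r0 rM] := HM.
apply/(@cvgrPdist_le _ _ _ (nbhs x)) => /= e e0.
have e'0 : 0 < e / (M * n.+1%:R) by rewrite divr_gt0// mulr_gt0.
apply/nbhs_ballP; exists (Num.min r (e / (M * n.+1%:R))) => /=.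
  by rewrite lt_min r0.
move=> y; rewrite -ball_normE/= distrC lt_min => /andP[yr ye].
rewrite distrC.
apply: le_trans (@C1_lipschitz_near _ x y M f1 _) _.
  move=> z i zx; apply: rM; rewrite -ball_normE/= distrC.
  apply: le_lt_trans yr; apply: norm_le_coord => // j; rewrite !mxE.
  by apply: (le_trans (zx j)); have := coord_le_norm (y - x) j; rewrite !mxE.
apply: (@le_trans _ _ (M * (n%:R * `|y - x|))).
  rewrite ler_wpM2l ?(ltW M0)//; apply: le_trans (sum_coord_le_norm (y - x)).
  by apply: ler_sum => i _; rewrite !mxE.
rewrite mulrA; apply: (@le_trans _ _ (M * n.+1%:R * `|y - x|)).
  by rewrite ler_wpM2r// ler_wpM2l ?(ltW M0)// ler_nat.
by rewrite mulrC -ler_pdivlMr ?mulr_gt0// ltW.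
Qed.

End C1_calculus.
Section continuity.
Context {R : realType} {T : topologicalType}.
Implicit Types f g : T -> R.

Lemma ctsD f g :
  continuous f -> continuous g -> continuous (fun x => f x + g x).
Proof. by move=> cf cg x; exact: (continuousD (cf x) (cg x)). Qed.

Lemma ctsM f g :
  continuous f -> continuous g -> continuous (fun x => f x * g x).
Proof. by move=> cf cg x; exact: (continuousM (cf x) (cg x)). Qed.

End continuity.

Section C1_closure.
Context {R : realType} {n : nat}.
Implicit Types (f g : 'rV[R]_n -> R) (x y v : 'rV[R]_n).

(** Transfers rules for functions of one variable, such as the chain rule, to
    directional derivatives. *)
Lemma is_derive_lineP f v x (d : R) :
  is_derive x v f d <-> is_derive (0 : R) 1 (fun t : R => f (t *: v + x)) d.
Proof.
have E : (fun h : R => h^-1 *: (f ((h *: 1 + 0) *: v + x) - f (0 *: v + x)))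
       = (fun h : R => h^-1 *: (f (h *: v + x) - f x)).
  by apply/funext => h; rewrite addr0 scale0r add0r (_ : h *: 1 = h)//; exact: mulr1.
by split=> -[df fd]; apply: DeriveDef; move: df fd; rewrite /derivable /derive E.
Qed.

Lemma is_derive_chain f (g : R -> R) v x (df dg : R) :
  is_derive x v f df -> is_derive (f x) 1 g dg ->
  is_derive x v (fun y => g (f y)) (dg * df).
Proof.
move=> /is_derive_lineP fx gx; apply/is_derive_lineP.
apply: (@is_derive1_comp _ g (fun t : R => f (t *: v + x))).
by rewrite scale0r add0r.
Qed.

Lemma is_derive_C1 f i x : C1 f ->
  is_derive x (delta_mx ord0 i) f ('D_(delta_mx ord0 i) f x).
Proof. by move=> f1; apply: derivableP; have [] := f1 i. Qed.

Lemma C1_of_is_derive f (df : 'I_n -> 'rV[R]_n -> R) :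
  (forall i x, is_derive x (delta_mx ord0 i) f (df i x)) ->
  (forall i, continuous (df i)) -> C1 f.
Proof.
move=> fdf cdf i; split=> [x|]; first by have [] := fdf i x.
rewrite (_ : (fun _ => _) = df i) //.
by apply/funext => x; have [_] := fdf i x.
Qed.

Lemma C1_cst (c : R) : @C1 R n (fun=> c).
Proof.
by apply: (@C1_of_is_derive _ (fun=> fun=> 0)) => i x; exact: cst_continuous.
Qed.

Lemma C1_coord i : C1 (fun x => x ord0 i).
Proof.
apply: (@C1_of_is_derive _ (fun j => fun=> (j == i)%:R)) => [j x|j x]; last first.
  exact: cst_continuous.
apply/is_derive_lineP.
rewrite (_ : (fun t : R => _) = (fun t : R => t * (j == i)%:R + x ord0 i)).
  by apply: is_derive_eq; rewrite /GRing.scale/= !(mulr0, mulr1, add0r, addr0).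
by apply/funext => t; rewrite !mxE eqxx/= eq_sym.
Qed.

Lemma C1D f g : C1 f -> C1 g -> C1 (fun x => f x + g x).
Proof.
move=> f1 g1.
apply: (@C1_of_is_derive _ (fun i x => 'D_(delta_mx ord0 i) f x + 'D_(delta_mx ord0 i) g x)).
  by move=> i x; apply: is_deriveD; exact: is_derive_C1.
by move=> i; apply: ctsD; [have [_] := f1 i|have [_] := g1 i].
Qed.

Lemma C1M f g : C1 f -> C1 g -> C1 (fun x => f x * g x).
Proof.
move=> f1 g1.
apply: (@C1_of_is_derive _ (fun i x => f x * 'D_(delta_mx ord0 i) g x +
                           g x * 'D_(delta_mx ord0 i) f x)).
  by move=> i x; apply: is_deriveM; exact: is_derive_C1.
move=> i; apply: ctsD; apply: ctsM; try exact: C1_continuous.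
  by have [_] := g1 i.
by have [_] := f1 i.
Qed.

Lemma C1_comp (g g' : R -> R) f : (forall t : R, is_derive t 1 g (g' t)) ->
  continuous g' -> C1 f -> C1 (fun x => g (f x)).
Proof.
move=> gg' cg' f1.
apply: (@C1_of_is_derive _ (fun i x => g' (f x) * 'D_(delta_mx ord0 i) f x)).
  by move=> i x; apply: is_derive_chain => //; exact: is_derive_C1.
move=> i; apply: ctsM; last by have [_] := f1 i.
by move=> x; apply: (@continuous_comp _ _ _ f g' x (@C1_continuous _ _ f f1 x) (cg' (f x))).
Qed.

Lemma C1_prod (I : Type) (r : seq I) (F : I -> 'rV[R]_n -> R) :
  (forall i, C1 (F i)) -> C1 (fun x => \prod_(i <- r) F i x).
Proof.
move=> F1; elim: r => [|i r IHr].
  by rewrite (_ : (fun _ => _) = (fun=> 1)); [exact: C1_cst|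
    apply/funext => x; rewrite big_nil].
rewrite (_ : (fun _ => _) = (fun x => F i x * \prod_(i <- r) F i x)).
  exact: C1M.
by apply/funext => x; rewrite big_cons.
Qed.

Lemma C1X f k : C1 f -> C1 (fun x => f x ^+ k).
Proof.
move=> f1; elim: k => [|k IHk].
  by rewrite (_ : (fun _ => _) = (fun=> 1)); [exact: C1_cst|
    apply/funext => x; rewrite expr0].
rewrite (_ : (fun _ => _) = (fun x => f x * f x ^+ k)); first exact: C1M.
by apply/funext => x; rewrite exprS.
Qed.

Lemma C1N f : C1 f -> C1 (fun x => - f x).
Proof.
move=> f1; rewrite (_ : (fun _ => _) = (fun x => -1 * f x)).
  by apply: C1M => //; exact: C1_cst.
by apply/funext => x; rewrite mulN1r.
Qed.

Lemma C1B f g : C1 f -> C1 g -> C1 (fun x => f x - g x).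
Proof. by move=> f1 g1; apply: C1D => //; exact: C1N. Qed.

End C1_closure.

(** * Smooth substitutes for the positive part *)

Section smooth_functions_of_one_variable.
Context {R : realType}.

Definition sqr_pos (t : R) : R := Num.max t 0 ^+ 2.

(** The error of the first-order expansion lies between 0 and the square of
    the increment, also across the corner of the positive part. *)
Lemma is_derive_sqr_pos (t : R) : is_derive t 1 sqr_pos (2 * Num.max t 0).
Proof.
have H (h : R) :
    `|sqr_pos (h + t) - sqr_pos t - 2 * Num.max t 0 * h| <= `|h| * `|h|.
  rewrite -normrM (@ger0_norm _ (h * h)); last by rewrite -expr2 sqr_ge0.
  rewrite /sqr_pos ler_norml !maxEle.
  by case: ifPn; case: ifPn => ? ?; nra.
have C : h^-1 *: (sqr_pos (h *: 1 + t) - sqr_pos t) @[h --> 0^'] -->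
    2 * Num.max t 0.
  apply/cvgrPdist_le => e e0; near=> h.
  have h0 : h != 0 by near: h; exact: nbhs_dnbhs_neq.
  rewrite (_ : h *: 1 = h); last exact: mulr1.
  rewrite distrC.
  have -> : h^-1 *: (sqr_pos (h + t) - sqr_pos t) - 2 * Num.max t 0 =
     h^-1 * (sqr_pos (h + t) - sqr_pos t - 2 * Num.max t 0 * h).
    by rewrite mulrBr mulrCA mulVf// mulr1.
  rewrite normrM normfV ler_pdivrMl ?normr_gt0//.
  apply: (le_trans (H h)); rewrite ler_wpM2l//.
  by near: h; apply: dnbhs0_le.
by apply: DeriveDef; [exact: cvgP C|exact: cvg_lim C].
Unshelve. all: by end_near.
Qed.

Lemma sqr_pos_ge0 (t : R) : 0 <= sqr_pos t.
Proof. exact: sqr_ge0. Qed.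

Lemma sqr_pos_gt0 (t : R) : (0 < sqr_pos t) = (0 < t).
Proof.
rewrite /sqr_pos maxEle; case: (leP t 0) => [t0|t0]; first by rewrite expr0n/= ltxx.
by rewrite exprn_gt0.
Qed.

Lemma sqr_pos_le1 (t : R) : t <= 1 -> sqr_pos t <= 1.
Proof. by rewrite /sqr_pos maxEle; case: ifPn => ? ?; nra. Qed.

(** A smooth approximation of the absolute value; it induces softpos for the
    positive part and softstep, the derivative of softpos, for the Heaviside
    function. *)
Definition softabs (d w : R) : R := Num.sqrt (w ^+ 2 + d ^+ 2).
Definition softpos (d w : R) : R := (w + softabs d w) / 2.
Definition softstep (d w : R) : R := (1 + w / softabs d w) / 2.
Definition softstep' (d w : R) : R := d ^+ 2 / softabs d w ^+ 3 / 2.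

Variable d : R.
Hypothesis d0 : 0 < d.

Lemma softabs_gt0 w : 0 < softabs d w.
Proof. by rewrite sqrtr_gt0 ltr_wpDl ?sqr_ge0// exprn_gt0. Qed.

Lemma sqr_softabs w : softabs d w ^+ 2 = w ^+ 2 + d ^+ 2.
Proof. by rewrite sqr_sqrtr// addr_ge0// sqr_ge0. Qed.

Lemma normr_le_softabs w : `|w| <= softabs d w.
Proof.
rewrite -ler_sqr ?nnegrE ?(ltW (softabs_gt0 _))// sqr_softabs.
by rewrite real_normK ?num_real// lerDl sqr_ge0.
Qed.

Lemma softabs_le w : softabs d w <= `|w| + d.
Proof.
rewrite -ler_sqr ?nnegrE ?(ltW (softabs_gt0 _))//; last by rewrite addr_ge0// ltW.
rewrite sqr_softabs sqrrD real_normK ?num_real// -addrA lerD2l lerDr.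
by rewrite mulrn_wge0// mulr_ge0// ltW.
Qed.

Lemma softpos_dist w : `|softpos d w - Num.max w 0| <= d.
Proof.
have := normr_le_softabs w; have := softabs_le w; rewrite /softpos.
rewrite maxEle; have [w0|w0] := leP w 0.
  by rewrite ler0_norm// => ? ?; rewrite ler_norml; apply/andP; split; lra.
by rewrite gtr0_norm// => ? ?; rewrite ler_norml; apply/andP; split; lra.
Qed.

Lemma softstep_itv w : 0 <= softstep d w <= 1.
Proof.
have := normr_le_softabs w; rewrite ler_norml => /andP[h1 h2].
have s0 := softabs_gt0 w.
have : -1 <= w / softabs d w by rewrite ler_pdivlMr// mulN1r.
have : w / softabs d w <= 1 by rewrite ler_pdivrMr// mul1r.
by rewrite /softstep => ? ?; apply/andP; split; lra.
Qed.

Lemma is_derive_softabs (w : R) :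
  is_derive w 1 (softabs d) (w / softabs d w).
Proof.
have s0 : 0 < w ^+ 2 + d ^+ 2 by rewrite ltr_wpDl ?sqr_ge0// exprn_gt0.
have H : is_derive w 1 (fun w : R => w ^+ 2 + d ^+ 2) (w *+ 2).
  by apply: is_derive_eq; rewrite /GRing.scale/=; ring.
have := @is_derive1_comp _ Num.sqrt _ w _ _ (is_derive1_sqrt s0) H.
rewrite (_ : _ * _ = w / softabs d w)//.
rewrite -/(softabs d w) -mulr_natl invfM; field.
by rewrite gt_eqF ?softabs_gt0.
Qed.

Lemma is_derive_softpos (w : R) : is_derive w 1 (softpos d) (softstep d w).
Proof.
have ? := is_derive_softabs w.
have -> : softpos d = 2^-1 \*: (id + softabs d).
  by apply/funext => t; rewrite /softpos mulrC.
by apply: is_derive_eq; rewrite /softstep /GRing.scale/= mulrC.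
Qed.

Lemma is_derive_softstep (w : R) : is_derive w 1 (softstep d) (softstep' d w).
Proof.
have ? := is_derive_softabs w.
have s0 := softabs_gt0 w.
have sn0 : softabs d w != 0 by rewrite gt_eqF.
have ? := is_deriveV sn0 (is_derive_softabs w).
have -> : softstep d = 2^-1 \*: (cst 1 + id * (fun t => (softabs d t)^-1)).
  by apply/funext => t; rewrite /softstep mulrC.
apply: is_derive_eq; rewrite /softstep' /GRing.scale/= add0r mulr1.
have -> : d ^+ 2 = softabs d w ^+ 2 - w ^+ 2 by rewrite sqr_softabs addrAC subrr add0r.
by field.
Qed.

Lemma continuous_softabs : continuous (softabs d).
Proof.
move=> w; apply: differentiable_continuous.
by apply/derivable1_diffP; have [] := is_derive_softabs w.
Qed.

Lemma continuous_softstep : continuous (softstep d).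
Proof.
move=> w; apply: differentiable_continuous.
by apply/derivable1_diffP; have [] := is_derive_softstep w.
Qed.

Lemma continuous_softstep' : continuous (softstep' d).
Proof.
apply: ctsM; last by move=> w; exact: cst_continuous.
apply: ctsM; first by move=> w; exact: cst_continuous.
move=> w; apply: (@continuousV _ _ (fun t => softabs d t ^+ 3)).
  by rewrite expf_neq0// gt_eqF// softabs_gt0.
apply: (@continuous_comp _ _ _ (softabs d) (fun t : R => t ^+ 3)).
  exact: continuous_softabs.
exact: exprn_continuous.
Qed.

End smooth_functions_of_one_variable.
(** * Translation invariance of Lebesgue measure *)

Section lebesgue_rV_basics.
Context {R : realType}.

Definition cube n (M : R) : set 'rV[R]_n := [set x | `|x| <= M].

Lemma bounded_subset_cube n (A : set 'rV[R]_n) : bounded_set A ->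
  exists M : R, 0 < M /\ A `<=` @cube n M.
Proof.
move=> [M [_ AM]]; exists (Num.max M 0 + 1); split.
  by rewrite ltr_wpDl// le_max lexx orbT.
by move=> x /AM; apply; rewrite ltr_pwDr// le_max lexx.
Qed.

Lemma continuous_measurable_rV n (f : 'rV[R]_n -> R) :
  continuous f -> measurable_fun setT f.
Proof.
move=> /continuousP cf; apply: (measurability _ (RGenOpens.measurableE R)).
move=> _ [_ [a [b ->]] <-]; rewrite setTI; apply: open_measurable_rV.
by apply: cf; exact: interval_open.
Qed.

Lemma closed_measurable_rV n (A : set 'rV[R]_n) : closed A -> measurable A.
Proof.
move=> cA; rewrite -(setCK A); apply: measurableC.
by apply: open_measurable_rV; exact: closed_openC.
Qed.

Lemma closed_norm_le n (M : R) : closed (@cube n M).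
Proof.
rewrite (_ : @cube n M = (fun x : 'rV[R]_n => `|x|) @^-1` [set r | r <= M])//.
apply: (@closed_comp _ _ (fun x : 'rV[R]_n => `|x|)).
  by move=> x _; exact: norm_continuous.
exact: closed_le.
Qed.

Lemma measurable_norm_le n (M : R) : measurable (@cube n M).
Proof. by apply: closed_measurable_rV; exact: closed_norm_le. Qed.

Lemma lebesgue_norm_le_lty n (M : R) :
  (lebesgue_rV n (@cube n M) < +oo)%E.
Proof.
have [M0|M0] := ltP M 0.
  rewrite (_ : @cube n M = set0) ?measure0//.
  apply/seteqP; split => // x /= xM.
  by have := le_lt_trans xM M0; rewrite ltNge normr_ge0.
have := @lebesgue_rV_box R n (const_mx (- M)) (const_mx M).
rewrite (_ : [set v | _] = @cube n M).
  by move=> ->; rewrite ?ltry// => i; rewrite !mxE lerNl (le_trans _ M0)// oppr_le0.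
apply/seteqP; split => [x xM|x xM i] /=.
  by apply: norm_le_coord => // i; have := xM i; rewrite !mxE ler_norml.
by rewrite !mxE -ler_norml (le_trans (coord_le_norm x i)).
Qed.

Lemma lebesgue_measure_shift (a : R) (A : set (measurableTypeR R)) :
  measurable A ->
  lebesgue_measure ((fun x : measurableTypeR R => x + a) @^-1` A)
  = lebesgue_measure A.
Proof.
move=> mA.
have mf : measurable_fun setT (fun x : measurableTypeR R => x + a : measurableTypeR R).
  by apply: measurable_funD => //; exact: measurable_cst.
pose f_mixin := isMeasurableFun.Build _ _ _ _ _ mf.
pose f : {mfun _ >-> _} := HB.pack (fun x : measurableTypeR R => x + a : measurableTypeR R) f_mixin.
apply/esym.
apply: (@lebesgue_measure_unique R (pushforward lebesgue_measure f)) => //.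
move=> _ [[b c]] _ <-; rewrite /= /pushforward.
have -> : f @^-1` `]b, c] = `]b - a, c - a]%classic.
  by apply/seteqP; split => x; rewrite /= !in_itv/= ltrBlDr lerBrDr.
by rewrite !lebesgue_measure_itv/= !lte_fin ltrD2r -!EFinB opprD addrACA subrr addr0.
Qed.

(** A translation acts separately on the first coordinate and on the others,
    and a product measure is determined by its values on rectangles. *)
Lemma lebesgue_rV_shift n (z : 'rV[R]_n) (A : set 'rV[R]_n) : measurable A ->
  lebesgue_rV n ((fun x => x + z) @^-1` A) = lebesgue_rV n A.
Proof.
elim: n z A => [|n IHn] z A mA.
  congr (_ _); apply/seteqP; split => x; rewrite /preimage/=;
    by rewrite (_ : x + z = x)//; apply/rowP => -[].
rewrite -[LHS]/((lebesgue_measure \x lebesgue_rV n)%E (rV_cons @^-1` _)).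
rewrite -[RHS]/((lebesgue_measure \x lebesgue_rV n)%E (rV_cons @^-1` _)).
pose T (p : measurableTypeR R * 'rV[R]_n) : measurableTypeR R * 'rV[R]_n :=
  (p.1 + (rV_uncons z).1, p.2 + (rV_uncons z).2).
have mT : measurable_fun setT T.
  apply/measurable_fun_pairP; split => /=.
    apply: measurable_funD => //; exact: measurable_fst.
  apply: measurable_fun_rV => i; under eq_fun do rewrite !mxE.
  apply: measurable_funD => //.
  exact: (measurableT_comp (measurable_coord_rV i) measurable_snd).
pose T_mixin := isMeasurableFun.Build _ _ _ _ _ mT.
pose f : {mfun _ >-> _} := HB.pack T T_mixin.
have mA' : measurable (rV_cons @^-1` A).
  by rewrite -[X in measurable X]setTI; exact: measurable_rV_cons.
have -> : rV_cons @^-1` ((fun x => x + z) @^-1` A) = f @^-1` (rV_cons @^-1` A).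
  apply/seteqP; split => p /=; rewrite (_ : rV_cons p + z = rV_cons (f p))//.
    apply/rowP => i; rewrite mxE; have [j ->|->] := unliftP ord0 i.
      by rewrite !rV_cons_lift !mxE.
    by rewrite !rV_cons0.
  apply/rowP => i; rewrite mxE; have [j ->|->] := unliftP ord0 i.
    by rewrite !rV_cons_lift !mxE.
  by rewrite !rV_cons0.
apply/esym.
apply: (@product_measure_unique _ _ _ _ R lebesgue_measure (lebesgue_rV n)
  (pushforward (lebesgue_measure \x lebesgue_rV n)%E f)) => //.
move=> B C mB mC; rewrite /= /pushforward.
have -> : f @^-1` (B `*` C) =
    ((fun x => x + (rV_uncons z).1) @^-1` B) `*`
    ((fun x => x + (rV_uncons z).2) @^-1` C) by [].
have ms k (w : 'rV[R]_k) (D : set 'rV[R]_k) : measurable D ->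
    measurable ((fun x => x + w) @^-1` D).
  move=> mD; rewrite -[X in measurable X]setTI.
  have : measurable_fun setT (fun x : 'rV[R]_k => x + w).
    apply: measurable_fun_rV => i; under eq_fun do rewrite !mxE.
    by apply: measurable_funD => //; exact: measurable_coord_rV.
  by move=> /(_ measurableT _ mD).
rewrite product_measure1E//; last 2 first.
- rewrite -[X in measurable X]setTI.
  have : measurable_fun setT (fun x : measurableTypeR R =>
      x + (rV_uncons z).1 : measurableTypeR R).
    by apply: measurable_funD => //; exact: measurable_cst.
  by move=> /(_ measurableT _ mB).
- exact: ms.
by rewrite IHn//; congr (_ * _)%E; exact: lebesgue_measure_shift.
Qed.

End lebesgue_rV_basics.
(** * Integrals of bounded functions with bounded support *)

Section bounded_functions_with_bounded_support.
Context {R : realType} {n : nat}.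
Local Notation mu := (lebesgue_rV n).
Implicit Types (f g : 'rV[R]_n -> R) (E : set 'rV[R]_n).

(** A single constant bounds both the values and the radius of the support, as
    either of the two can always be enlarged. *)
Definition bbs f : Prop := measurable_fun setT f /\
  exists M : R, forall x, `|f x| <= M /\ (M < `|x| -> f x = 0).

Lemma bbsI f (A B : R) : measurable_fun setT f -> (forall x, `|f x| <= A) ->
  (forall x, B < `|x| -> f x = 0) -> bbs f.
Proof.
move=> mf fA fB; split => //; exists (Num.max A B) => x.
split; first by rewrite le_max fA.
by rewrite gt_max => /andP[_]; exact: fB.
Qed.

Lemma compact_cube (M : R) : compact (@cube R n M).
Proof.
apply: bounded_closed_compact; last exact: closed_norm_le.
exists M; split; first exact: num_real.
by move=> N MN x /= xM; rewrite (le_trans xM)// ltW.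
Qed.

Lemma cts_bounded_cube f (M : R) : continuous f ->
  exists2 C : R, 0 <= C & forall x, `|x| <= M -> `|f x| <= C.
Proof.
move=> cf.
have cfM : {within @cube R n M, continuous f}.
  by apply: continuous_subspaceT.
have /compact_bounded[C [_ CM]] := continuous_compact cfM (@compact_cube M).
exists (Num.max C 0 + 1); first by rewrite addr_ge0// le_max lexx orbT.
move=> x xM; apply: (CM (Num.max C 0 + 1)); last by exists x.
by rewrite ltr_pwDr// le_max lexx.
Qed.

Lemma bbs_cts f (B : R) : continuous f ->
  (forall x, B < `|x| -> f x = 0) -> bbs f.
Proof.
move=> cf fB; have [C C0 fC] := cts_bounded_cube B cf.
apply: (@bbsI f C B) => //; first exact: continuous_measurable_rV.
move=> x; have [xB|Bx] := leP `|x| B; first exact: fC.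
by rewrite fB// normr0.
Qed.

Lemma bbsMb f g (C : R) : bbs f -> measurable_fun setT g ->
  (forall x, `|g x| <= C) -> bbs (fun x => f x * g x).
Proof.
move=> [mf [M fM]] mg gC.
apply: (@bbsI _ (M * C) M); first exact: measurable_funM.
  by move=> x; rewrite normrM; apply: ler_pM => //; have [] := fM x.
by move=> x /(proj2 (fM x)) ->; rewrite mul0r.
Qed.

(** A continuous factor may be unbounded: only its values on the compact cube
    that carries f matter. *)
Lemma bbsM f g : bbs f -> continuous g -> bbs (fun x => f x * g x).
Proof.
move=> [mf [M fM]] cg; have [C C0 gC] := cts_bounded_cube M cg.
apply: (@bbsI _ (M * C) M).
- by apply: measurable_funM => //; exact: continuous_measurable_rV.
- move=> x; have [xM|Mx] := leP `|x| M.
    by rewrite normrM; apply: ler_pM => //; [have [] := fM x|exact: gC].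
  have [fxM /(_ Mx) ->] := fM x; rewrite mul0r normr0 mulr_ge0//.
  by apply: le_trans fxM.
- by move=> x /(proj2 (fM x)) ->; rewrite mul0r.
Qed.

Lemma bbsD f g : bbs f -> bbs g -> bbs (fun x => f x + g x).
Proof.
move=> [mf [M fM]] [mg [N gN]].
apply: (@bbsI _ (M + N) (Num.max M N)); first exact: measurable_funD.
  move=> x; apply: le_trans (ler_normD _ _) _; apply: lerD.
    by have [] := fM x.
  by have [] := gN x.
move=> x; rewrite gt_max => /andP[/(proj2 (fM x)) -> /(proj2 (gN x)) ->].
by rewrite addr0.
Qed.

Lemma bbsZ f (c : R) : bbs f -> bbs (fun x => c * f x).
Proof.
move=> bf; rewrite (_ : (fun _ => _) = (fun x => f x * c)).
  by apply: bbsM => // x; exact: cst_continuous.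
by apply/funext => x; rewrite mulrC.
Qed.

Lemma bbsN f : bbs f -> bbs (fun x => - f x).
Proof.
move=> bf; rewrite (_ : (fun _ => _) = (fun x => -1 * f x)).
  exact: bbsZ.
by apply/funext => x; rewrite mulN1r.
Qed.

Lemma bbsB f g : bbs f -> bbs g -> bbs (fun x => f x - g x).
Proof. by move=> bf bg; apply: bbsD => //; exact: bbsN. Qed.

Lemma bbs_norm f : bbs f -> bbs (fun x => `|f x|).
Proof.
move=> [mf [M fM]]; apply: (@bbsI _ M M).
- exact: measurableT_comp.
- by move=> x; rewrite normr_id; have [] := fM x.
- by move=> x /(proj2 (fM x)) ->; rewrite normr0.
Qed.

Lemma measurable_rV_add (z : 'rV[R]_n) :
  measurable_fun setT (fun x : 'rV[R]_n => x + z).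
Proof.
apply: measurable_fun_rV => i; under eq_fun do rewrite !mxE.
by apply: measurable_funD => //; exact: measurable_coord_rV.
Qed.

Lemma bbs_shift f z : bbs f -> bbs (fun x => f (x + z)).
Proof.
move=> [mf [M fM]]; apply: (@bbsI _ M (M + `|z|)).
- by apply: (measurableT_comp mf); exact: measurable_rV_add.
- by move=> x; have [] := fM (x + z).
- move=> x; rewrite -ltrBrDr => Mx; apply: (proj2 (fM _)).
  by apply: lt_le_trans Mx _; rewrite lerBlDr -{1}(addrK z x) ler_normB.
Qed.

Lemma bbs_indic E : measurable E -> bounded_set E -> bbs \1_E.
Proof.
move=> mE /bounded_subset_cube[M [_ EM]]; apply: (@bbsI _ 1 M) => //.
- by move=> x; rewrite indicE; case: (_ \in _); rewrite /= ?normr1 ?normr0.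
- move=> x Mx; rewrite indicE memNset// => /EM /=.
  by rewrite /cube/= leNgt Mx.
Qed.

Lemma bbs_integrable f : bbs f -> mu.-integrable setT (EFin \o f).
Proof.
move=> [mf [M fM]].
have -> : f = f \_ (cube M).
  apply/funext => x; rewrite patchE; case: ifPn => //.
  rewrite notin_setE /cube/= => /negP; rewrite -ltNge.
  exact: (proj2 (fM x)).
rewrite -restrict_EFin.
apply/(integrable_mkcond (EFin \o f) (@measurable_norm_le R n M)).
apply: measurable_bounded_integrable.
- exact: measurable_norm_le.
- exact: lebesgue_norm_le_lty.
- exact: measurable_funTS.
- exists M; split; first exact: num_real.
  by move=> N MN x _ /=; rewrite (le_trans _ (ltW MN))//; have [] := fM x.
Qed.

Lemma EFin_int f : bbs f -> (\int[mu]_x f x)%:E = (\int[mu]_x (f x)%:E)%E.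
Proof.
by move=> bf; rewrite /Rintegral fineK// integrable_fin_num// bbs_integrable.
Qed.

Lemma intD f g : bbs f -> bbs g ->
  \int[mu]_x (f x + g x) = \int[mu]_x f x + \int[mu]_x g x.
Proof. by move=> bf bg; rewrite RintegralD//; exact: bbs_integrable. Qed.

Lemma intB f g : bbs f -> bbs g ->
  \int[mu]_x (f x - g x) = \int[mu]_x f x - \int[mu]_x g x.
Proof. by move=> bf bg; rewrite RintegralB//; exact: bbs_integrable. Qed.

Lemma intZ c f : bbs f -> \int[mu]_x (c * f x) = c * \int[mu]_x f x.
Proof. by move=> bf; rewrite RintegralZl//; exact: bbs_integrable. Qed.

Lemma intN f : bbs f -> \int[mu]_x (- f x) = - \int[mu]_x f x.
Proof.
by move=> bf; rewrite -mulN1r -intZ//; apply: eq_Rintegral => x _; rewrite mulN1r.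
Qed.

Lemma le_int f g : bbs f -> bbs g -> (forall x, f x <= g x) ->
  \int[mu]_x f x <= \int[mu]_x g x.
Proof. by move=> bf bg fg; apply: le_Rintegral => //; exact: bbs_integrable. Qed.

Lemma norm_int_le f : bbs f -> `|\int[mu]_x f x| <= \int[mu]_x `|f x|.
Proof. by move=> bf; apply: le_normr_Rintegral => //; exact: bbs_integrable. Qed.

Lemma int_ge0 f : (forall x, 0 <= f x) -> 0 <= \int[mu]_x f x.
Proof. by move=> f0; exact: Rintegral_ge0. Qed.

Lemma int_indic E : measurable E -> \int[mu]_x \1_E x = fine (mu E).
Proof. by move=> mE; rewrite /Rintegral integral_indic// setIT. Qed.

Lemma int_shift f z : bbs f -> \int[mu]_x f (x + z) = \int[mu]_x f x.
Proof.
move=> bf; apply: EFin_inj; rewrite !EFin_int//; last exact: bbs_shift.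
have mz := measurable_rV_add z.
have := @integral_pushforward _ _ _ _ R _ mz mu setT (EFin \o f).
rewrite preimage_setT => H; rewrite -[LHS]H//.
- apply: eq_measure_integral => A mA _; exact: lebesgue_rV_shift.
- by apply/measurable_EFinP; have [] := bf.
- exact: bbs_integrable (bbs_shift z bf).
Qed.

Lemma sum_bbs (I : Type) (r : seq I) (F : I -> 'rV[R]_n -> R) :
  (forall i, bbs (F i)) -> bbs (fun x => \sum_(i <- r) F i x).
Proof.
move=> bF; elim: r => [|i r IHr].
  rewrite (_ : (fun _ => _) = (fun=> 0)); last first.
    by apply/funext => x; rewrite big_nil.
  by apply: (@bbs_cts _ 0) => // x; exact: cst_continuous.
rewrite (_ : (fun _ => _) = (fun x => F i x + \sum_(i <- r) F i x)).
  exact: bbsD.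
by apply/funext => x; rewrite big_cons.
Qed.

Lemma int_sum (I : Type) (r : seq I) (F : I -> 'rV[R]_n -> R) :
  (forall i, bbs (F i)) ->
  \int[mu]_x (\sum_(i <- r) F i x) = \sum_(i <- r) \int[mu]_x F i x.
Proof.
move=> bF; elim: r => [|i r IHr].
  rewrite big_nil; under eq_Rintegral do rewrite big_nil.
  by rewrite Rintegral_cst// mul0r.
rewrite big_cons -IHr -intD//; last exact: sum_bbs.
by apply: eq_Rintegral => x _; rewrite big_cons.
Qed.

End bounded_functions_with_bounded_support.
(** * Correlations *)

Section correlation.
Context {R : realType} {n : nat}.
Local Notation mu := (lebesgue_rV n).
Implicit Types (f g w phi : 'rV[R]_n -> R) (E : set 'rV[R]_n) (x y z : 'rV[R]_n).

(** Heine's theorem, as an instance of the covering form of compactness. *)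
Lemma cts_uniform_cube phi (M e : R) : continuous phi -> 0 < e ->
  \forall z \near (0 : 'rV[R]_n), forall x, `|x| <= M -> `|phi (x + z) - phi x| <= e.
Proof.
move=> cphi e0.
have := (@compact_near_coveringP _ (@cube R n M)).1 (@compact_cube R n M).
move=> /(_ _ (nbhs (0 : 'rV[R]_n)) (fun z x => `|phi (x + z) - phi x| <= e)).
move=> /(_ _) H; apply: H => x _.
have e20 : 0 < e / 2 by rewrite divr_gt0.
have /(@cvgrPdist_le _ _ _ (nbhs x)) /(_ _ e20) /nbhs_ballP [d /= d0 xd] := cphi x.
have d20 : 0 < d / 2 by rewrite divr_gt0.
exists (ball x (d / 2), ball (0 : 'rV[R]_n) (d / 2)).
  by split; apply: nbhsx_ballx.
move=> [x' z] /= [xx' z0].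
rewrite (le_trans (ler_distD (phi x) _ _))// (splitr e) lerD//.
  rewrite distrC; apply: xd; rewrite -ball_normE/=.
  move: xx' z0; rewrite -!ball_normE/= sub0r normrN => xx' z0.
  rewrite opprD addrA (splitr d); apply: le_lt_trans (ler_normB _ _) _.
  exact: ltrD.
apply: xd; apply: le_ball xx'; rewrite ler_pdivrMr// ler_pMr// ler1n//.
Qed.

(** The cross-correlation of w with phi, that is, the convolution of w with the
    reflection of phi. *)
Definition corr w phi x : R := \int[mu]_y (w y * phi (y - x)).

Lemma cts_shift phi z : continuous phi -> continuous (fun x => phi (x + z)).
Proof.
move=> cphi x; apply: (@continuous_comp _ _ _ (fun x => x + z) phi).
  by apply: continuousD; [exact: cvg_id|exact: cst_continuous].
exact: cphi.
Qed.

Lemma bbs_corr w phi x : bbs w -> continuous phi ->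
  bbs (fun y => w y * phi (y - x)).
Proof. by move=> bw cphi; apply: bbsM => //; exact: cts_shift. Qed.

Lemma corr_continuous w phi : bbs w -> continuous phi -> continuous (corr w phi).
Proof.
move=> bw cphi x.
have [_ [M wM]] := bw.
pose W := \int[mu]_y `|w y|.
have W0 : 0 <= W by exact: int_ge0.
apply/(@cvgrPdist_le _ _ _ (nbhs x)) => e e0.
have eW0 : 0 < e / (W + 1) by rewrite divr_gt0// ltr_wpDl.
have /nbhs_ballP[d /= d0 H] := cts_uniform_cube (M + `|x|) cphi eW0.
apply/nbhs_ballP; exists d => // x'; rewrite -ball_normE/= => xx'.
rewrite /corr -intB; [|exact: bbs_corr..].
apply: le_trans (norm_int_le _) _; first by apply: bbsB; exact: bbs_corr.
apply: (@le_trans _ _ (\int[mu]_y (e / (W + 1) * `|w y|))).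
  apply: le_int.
  - by apply: bbs_norm; apply: bbsB; exact: bbs_corr.
  - by apply: bbsZ; exact: bbs_norm.
  move=> y; rewrite -mulrBr normrM mulrC.
  have [yM|My] := leP `|y| M; last by rewrite (proj2 (wM y)) // normr0 !mulr0.
  apply: ler_wpM2r => //.
  have := H (x - x'); rewrite -ball_normE/= sub0r normrN => /(_ xx' (y - x)).
  rewrite addrA subrK (distrC (phi (y - x))); apply.
  by apply: le_trans (ler_normB _ _) _; rewrite lerD2r.
rewrite intZ; last exact: bbs_norm.
rewrite -/W mulrAC ler_pdivrMr ?ltr_wpDl//.
by rewrite ler_wpM2l ?ltW// ltrDl.
Qed.

(** Differentiation under the integral sign along the i-th axis. The domination
    comes from compactness: for a parameter in a bounded interval, phi is
    only evaluated on a fixed cube when y is in the support of w. *)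
Lemma is_derive_corr w phi i x : bbs w -> C1 phi ->
  is_derive x (delta_mx ord0 i) (corr w phi)
    (- corr w (fun y => 'D_(delta_mx ord0 i) phi y) x).
Proof.
move=> bw phi1; apply/is_derive_lineP.
set e := delta_mx ord0 i.
have [_ [M wM]] := bw.
have cd : continuous (fun x => 'D_e phi x) by have [] := phi1 i.
have cphi := C1_continuous phi1.
have [C C0 dC] := cts_bounded_cube (M + (`|e| + `|x|)) cd.
pose f (t : R) y := w y * phi (y - (t *: e + x)).
have fd (t : R) y : is_derive t 1 (f ^~ y) (- (w y * 'D_e phi (y - (t *: e + x)))).
  have H : is_derive t 1 (fun t : R => phi (y - (t *: e + x)))
      (- 'D_e phi (y - (t *: e + x))).
    have H1 : is_derive (- t) 1 (fun t : R => phi (t *: e + (y - x)))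
       ('D_e phi ((- t) *: e + (y - x))).
      by apply: is_derive_line; have [] := phi1 i.
    have H2 := @is_derive1_comp _ _ (fun t : R => - t) t _ _ H1 (is_deriveNid t 1).
    have E (s : R) : y - (s *: e + x) = (- s) *: e + (y - x).
      by rewrite scaleNr opprD addrCA.
    rewrite -mulrN1 E; under eq_fun do rewrite E.
    exact: H2.
  have := is_deriveZ (w y) H.
  by rewrite /GRing.scale/= mulrN.
have d1E (t : R) y : partial1of2 f t y = - (w y * 'D_e phi (y - (t *: e + x))).
  by rewrite partial1of2E; have [_] := fd t y.
have I0 : `](-1), 1[%classic (0 : R) by rewrite /= in_itv/= ltrN10 ltr01.
have intf (t : R) : `](-1), 1[%classic t -> mu.-integrable setT (EFin \o f t).
  by move=> _; apply: bbs_integrable; exact: bbs_corr.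
have derf (t : R) y : `](-1), 1[%classic t -> setT y -> derivable (f ^~ y) t 1.
  by move=> _ _; have [] := fd t y.
have G0 y : 0 <= C * `|w y| by rewrite mulr_ge0.
have iG : mu.-integrable setT (EFin \o (fun y => C * `|w y|)).
  by apply: bbs_integrable; apply: bbsZ; exact: bbs_norm.
have Gub (t : R) y : `](-1), 1[%classic t -> setT y ->
    `|partial1of2 f t y| <= C * `|w y|.
  rewrite /= in_itv/= -ltr_norml => t1 _.
  rewrite d1E normrN normrM mulrC.
  have [yM|My] := leP `|y| M; last by rewrite (proj2 (wM y)) // normr0 !mulr0.
  apply: ler_wpM2r => //; apply: dC.
  apply: le_trans (ler_normB _ _) _; apply: lerD => //.
  apply: le_trans (ler_normD _ _) _; rewrite lerD2r normrZ ler_piMl//.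
  exact: ltW.
have K := @derivable_under_integral _ _ _ mu f setT measurableT 0 (-1) 1 I0
  intf derf _ G0 iG Gub.
have L := @differentiation_under_integral _ _ _ mu f setT measurableT 0 (-1) 1 I0
  intf derf _ G0 iG Gub.
apply: DeriveDef; first exact: K.
rewrite -derive1E; rewrite /corr; rewrite [LHS]L.
rewrite -intN; last exact: (bbs_corr x bw cd).
by apply: eq_Rintegral => y _; rewrite d1E scale0r add0r.
Qed.

Lemma C1_corr w phi : bbs w -> C1 phi -> C1 (corr w phi).
Proof.
move=> bw phi1.
apply: (@C1_of_is_derive _ _ _ (fun i x => - corr w (fun y => 'D_(delta_mx ord0 i) phi y) x)).
  by move=> i x; exact: is_derive_corr.
move=> i x; have [_ cd] := phi1 i.
exact: (@continuousN _ _ _ _ x (@corr_continuous _ _ bw cd x)).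
Qed.

Lemma derive_corr w phi i x : bbs w -> C1 phi ->
  'D_(delta_mx ord0 i) (corr w phi) x =
  - corr w (fun y => 'D_(delta_mx ord0 i) phi y) x.
Proof. by move=> bw phi1; have [] := is_derive_corr i x bw phi1. Qed.

End correlation.
(** * Test fields and bounds on the perimeter *)

Section test_fields.
Context {R : realType} {n : nat}.
Local Notation mu := (lebesgue_rV n).
Implicit Types (f w phi : 'rV[R]_n -> R) (E : set 'rV[R]_n) (x y z : 'rV[R]_n).
Implicit Types (g : 'rV[R]_n -> 'rV[R]_n).

Let shift_quotient f v x z :
  (fun h : R => h^-1 *: (f (h *: v + x + z) - f (x + z)))
  = (fun h : R => h^-1 *: (f (h *: v + (x + z)) - f (x + z))).
Proof. by apply/funext => h; rewrite addrA. Qed.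

Lemma derive_shift_rV f v x z :
  'D_v (fun y => f (y + z)) x = 'D_v f (x + z).
Proof.
exact: (congr1 (fun q : R -> R => lim (q h @[h --> 0^'])) (shift_quotient f v x z)).
Qed.

Lemma derivable_shift_rV f v x z :
  derivable (fun y => f (y + z)) x v = derivable f (x + z) v.
Proof.
exact: (congr1 (fun q : R -> R => cvg (q h @[h --> 0^'])) (shift_quotient f v x z)).
Qed.

Lemma C1_shift f z : C1 f -> C1 (fun y => f (y + z)).
Proof.
move=> f1 i; have [df cdf] := f1 i; split=> [x|].
  by rewrite derivable_shift_rV.
rewrite (_ : (fun x => 'D_(delta_mx ord0 i) (fun y => f (y + z)) x)
    = (fun y => 'D_(delta_mx ord0 i) f (y + z))).
  exact: (@cts_shift _ _ _ z cdf).
by apply/funext => x; rewrite derive_shift_rV.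
Qed.

Lemma near_out (B : R) x : B < `|x| -> \forall y \near x, B < `|y|.
Proof.
move=> Bx; have : nbhs x (~` cube B).
  apply: open_nbhs_nbhs; split; first exact/closed_openC/closed_norm_le.
  by apply/negP; rewrite -ltNge.
by apply: filterS => y /negP; rewrite -ltNge.
Qed.

Lemma derive_out phi (B : R) v x : (forall x, B < `|x| -> phi x = 0) ->
  B < `|x| -> 'D_v phi x = 0.
Proof.
move=> phiB Bx; rewrite -(derive_cst (0 : R) x v); apply: near_eq_derive.
by near do apply: phiB; exact: near_out.
Unshelve. all: by end_near. Qed.

Lemma bbs_derive phi (B : R) i : C1 phi ->
  (forall x, B < `|x| -> phi x = 0) ->
  bbs (fun x => 'D_(delta_mx ord0 i) phi x).
Proof.
move=> phi1 phiB; apply: (@bbs_cts _ _ _ B); first by have [] := phi1 i.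
by move=> x; exact: derive_out.
Qed.

(** Translation invariance at work: when w is the indicator of a cube larger
    than the support of phi, the correlation of w with phi is constant near
    the origin, and its derivative there is the opposite of this integral. *)
Lemma int_derive_eq0 phi (B : R) i : C1 phi ->
  (forall x, B < `|x| -> phi x = 0) ->
  \int[mu]_x ('D_(delta_mx ord0 i) phi x) = 0.
Proof.
move=> phi1 phiB; pose C := cube (B + 1) : set 'rV[R]_n.
have bC : bbs (\1_C : 'rV[R]_n -> R).
  apply: bbs_indic; first exact: measurable_norm_le.
  exists (B + 1); split; first exact: num_real.
  by move=> N MN x /= xM; rewrite (le_trans xM)// ltW.
have cd : continuous (fun x => 'D_(delta_mx ord0 i) phi x) by have [] := phi1 i.
have bphi : bbs phi by apply: (@bbs_cts _ _ _ B) => //; exact: C1_continuous.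
have C1E x : `|x| <= B + 1 -> \1_C x = 1 :> R.
  by move=> xB; rewrite indicE mem_set.
have : 'D_(delta_mx ord0 i) (corr \1_C phi) 0 = 0.
  rewrite -(derive_cst (\int[mu]_y phi y) (0 : 'rV[R]_n) (delta_mx ord0 i)).
  apply: near_eq_derive; near=> x.
  have x1 : `|x| <= 1.
    near: x; apply/nbhs_ballP; exists 1 => //= y.
    by rewrite -ball_normE/= sub0r normrN => /ltW.
  rewrite /corr -[RHS](int_shift (- x) bphi); apply: eq_Rintegral => y _.
  have [yB|By] := leP `|y| (B + 1); first by rewrite C1E// mul1r.
  rewrite (phiB (y - x)) ?mulr0//.
  have := ler_normD (y - x) x; rewrite subrK => yx; lra.
rewrite derive_corr// => /eqP; rewrite oppr_eq0 => /eqP <-.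
apply: eq_Rintegral => y _; rewrite subr0.
have [yB|By] := leP `|y| (B + 1); first by rewrite C1E// mul1r.
by rewrite (derive_out _ phiB) ?mulr0//; lra.
Unshelve. all: by end_near. Qed.

(** Trades the compactness of the support for an explicit radius. *)
Lemma C1c_fieldP g : C1c_field g <->
  (forall i, C1 (fun x => g x ord0 i)) /\
  exists B : R, forall x, B < `|x| -> g x = 0.
Proof.
split=> -[g1 gc]; split=> //.
  have [B [_ gB]] := bounded_subset_cube (compact_bounded gc).
  exists B => x Bx; apply: contrapT => /eqP gx0.
  have : closure [set x | g x != 0] x by apply: subset_closure.
  by move=> /gB; rewrite /cube/= leNgt Bx.
have [B gB] := gc.
apply: bounded_closed_compact; last exact: closed_closure.
exists B; split; first exact: num_real.
move=> N BN x gx.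
have H : [set x | g x != 0] `<=` cube B.
  move=> y /= gy; rewrite /cube/= leNgt; apply/negP => /gB gy0.
  by rewrite gy0 eqxx in gy.
have : cube B x.
  by rewrite ((closure_id _).1 (@closed_norm_le R n B)); exact: closureS gx.
by rewrite /cube/= => xB; rewrite (le_trans xB)// ltW.
Qed.

Definition test_field g : Prop :=
  C1c_field g /\ forall x, eucl_norm (g x) <= 1.

Lemma bbs_divergence g : C1c_field g -> bbs (divergence g).
Proof.
move=> /C1c_fieldP[g1 [B gB]]; apply: sum_bbs => i.
by apply: (@bbs_derive _ B) => // x /gB ->; rewrite mxE.
Qed.

Lemma bbs_coord g i : C1c_field g -> bbs (fun x => g x ord0 i).
Proof.
move=> /C1c_fieldP[g1 [B gB]]; apply: (@bbs_cts _ _ _ B).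
  exact: C1_continuous.
by move=> x /gB ->; rewrite mxE.
Qed.

(** The inequality P(E) <= p written in the reals, test field by test field. *)
Definition perimeter_bound E (p : R) : Prop := forall g, test_field g ->
  \int[mu]_x (\1_E x * divergence g x) <= p.

Lemma bbs_indicM E f : measurable E -> bbs f -> bbs (fun x => \1_E x * f x).
Proof.
move=> mE bf; rewrite (_ : (fun _ => _) = (fun x => f x * \1_E x)).
  apply: (@bbsMb _ _ _ _ 1) => // x.
  by rewrite indicE; case: (_ \in _); rewrite /= ?normr1 ?normr0.
by apply/funext => x; rewrite mulrC.
Qed.

Lemma integral_set_indic E f : measurable E -> bbs f ->
  (\int[mu]_(x in E) (f x)%:E)%E = (\int[mu]_x (\1_E x * f x))%:E.
Proof.
move=> mE bf; rewrite EFin_int; last exact: bbs_indicM.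
rewrite integral_mkcond; apply: eq_integral => x _.
by rewrite patchE indicE; case: ifPn => _; rewrite /= ?mul1r ?mul0r.
Qed.

Lemma perimeter_leP E p : measurable E ->
  (perimeter E <= p%:E)%E <-> perimeter_bound E p.
Proof.
move=> mE; split=> [Ep g [gc g1]|Ep].
  rewrite -lee_fin -integral_set_indic//; last exact: bbs_divergence.
  by apply: le_trans Ep; apply: ereal_sup_ubound; exists g.
apply: ge_ereal_sup => _ [g [gc g1] <-].
rewrite integral_set_indic//; last exact: bbs_divergence.
by rewrite lee_fin; exact: Ep.
Qed.

Lemma test_field0 : test_field (fun=> 0).
Proof.
split.
  apply/C1c_fieldP; split; last by exists 0.
  move=> i; rewrite (_ : (fun _ => _) = (fun=> 0)); first exact: C1_cst.
  by apply/funext => x; rewrite mxE.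
move=> x; rewrite /eucl_norm big1 ?sqrtr0// => i _.
by rewrite mxE expr0n.
Qed.

Lemma divergence0 x : divergence (fun=> 0 : 'rV[R]_n) x = 0.
Proof.
rewrite /divergence big1// => i _.
rewrite (_ : (fun _ => _) = cst 0); first exact: derive_cst.
by apply/funext => y; rewrite mxE.
Qed.

Lemma perimeter_bound_ge0 E p : perimeter_bound E p -> 0 <= p.
Proof.
move=> /(_ _ test_field0); apply: le_trans.
by apply: int_ge0 => x; rewrite divergence0 mulr0.
Qed.

Lemma perimeter_ge0 E : measurable E -> (0 <= perimeter E)%E.
Proof.
move=> mE; apply: ereal_sup_ubound => /=; exists (fun=> 0).
  exact: test_field0.
by rewrite integral0_eq// => x _; rewrite divergence0.
Qed.

Definition coord_field phi i : 'rV[R]_n -> 'rV[R]_n :=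
  fun x => phi x *: delta_mx ord0 i.

Lemma divergence_coord_field phi i x :
  divergence (coord_field phi i) x = 'D_(delta_mx ord0 i) phi x.
Proof.
rewrite /divergence (bigD1 i)//= big1 ?addr0.
  by congr ('D_ _ _ _); apply/funext => y; rewrite !mxE !eqxx mulr1.
move=> j ji; rewrite (_ : (fun _ => _) = cst 0); first exact: derive_cst.
by apply/funext => y; rewrite !mxE (negbTE ji) andbF mulr0.
Qed.

Lemma test_coord_field phi (B : R) i : C1 phi ->
  (forall x, B < `|x| -> phi x = 0) -> (forall x, `|phi x| <= 1) ->
  test_field (coord_field phi i).
Proof.
move=> phi1 phiB philt; split.
  apply/C1c_fieldP; split=> [j|].
    rewrite (_ : (fun _ => _) = (fun x => phi x * (j == i)%:R)).
      by apply: C1M => //; exact: C1_cst.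
    by apply/funext => y; rewrite !mxE eqxx.
  by exists B => x /phiB; rewrite /coord_field => ->; rewrite scale0r.
move=> x; rewrite /eucl_norm (bigD1 i)//= big1 ?addr0.
  by rewrite !mxE !eqxx mulr1 sqrtr_sqr.
by move=> j ji; rewrite !mxE (negbTE ji) andbF mulr0 expr0n.
Qed.

(** Up to sign, this derivative is the integral over E of the divergence of the
    field phi e_i translated by z, which is a test field. *)
Lemma int_corr_derive_le E p phi (B : R) i z : bbs (\1_E : 'rV[R]_n -> R) ->
  perimeter_bound E p -> C1 phi ->
  (forall x, B < `|x| -> phi x = 0) -> (forall x, `|phi x| <= 1) ->
  `|'D_(delta_mx ord0 i) (corr \1_E phi) z| <= p.
Proof.
move=> bE Ep phi1 phiB philt.
have H (psi : 'rV[R]_n -> R) : C1 psi -> (forall x, B < `|x| -> psi x = 0) ->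
    (forall x, `|psi x| <= 1) ->
    - 'D_(delta_mx ord0 i) (corr \1_E psi) z <= p.
  move=> psi1 psiB psilt; rewrite derive_corr// opprK.
  have tf : test_field (coord_field (fun y => psi (y - z)) i).
    apply: (@test_coord_field _ (B + `|z|)).
    - exact: C1_shift.
    - by move=> x Bx; apply: psiB; have := ler_normD (x - z) z; rewrite subrK; lra.
    - by move=> x; exact: psilt.
  rewrite (_ : corr _ _ _ = \int[mu]_x
     (\1_E x * divergence (coord_field (fun y => psi (y - z)) i) x)); first exact: Ep.
  apply: eq_Rintegral => y _.
  by rewrite divergence_coord_field derive_shift_rV.
rewrite ler_norml lerNl H//=.
have := H (fun y => - phi y) (C1N phi1).
rewrite derive_corr ?opprK//; last exact: C1N.
rewrite (derive_corr _ _ bE phi1) /corr => K.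
have cd : continuous (fun x => 'D_(delta_mx ord0 i) phi x) by have [] := phi1 i.
rewrite -(intN (bbs_corr z bE cd)).
have -> : \int[mu]_x (- (\1_E x * 'D_(delta_mx ord0 i) phi (x - z))) =
   \int[mu]_y (\1_E y * 'D_(delta_mx ord0 i) (fun y : 'rV_n => - phi y) (y - z)).
  apply: eq_Rintegral => y _; rewrite -mulrN; congr (_ * _).
  by rewrite -deriveN//; have [] := phi1 i.
by apply: K => [x /phiB ->|x]; rewrite ?oppr0// normrN.
Qed.

End test_fields.
(** * Bumps and cut-offs *)

Section density.
Context {R : realType} {n : nat}.
Local Notation mu := (lebesgue_rV n).
Implicit Types (f w phi : 'rV[R]_n -> R) (A E : set 'rV[R]_n) (x y z : 'rV[R]_n).

Definition bump z (r : R) x : R :=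
  \prod_(i < n) sqr_pos (1 - ((x ord0 i - z ord0 i) * r^-1) ^+ 2).

Lemma C1_sqr_pos f : C1 f -> C1 (fun x => sqr_pos (f x)).
Proof.
move=> f1; apply: (C1_comp is_derive_sqr_pos _ f1).
move=> t; apply: (@continuousM _ _ (fun=> 2) (fun t : R => Num.max t 0) t).
  exact: cst_continuous.
apply: (@continuous_max _ _ (fun t : R => t) (fun=> 0)).
  exact: cvg_id.
exact: cst_continuous.
Qed.

Lemma C1_bump z r : C1 (bump z r).
Proof.
apply: C1_prod => i; apply: C1_sqr_pos; apply: C1B; first exact: C1_cst.
apply: C1X; apply: C1M; last exact: C1_cst.
by apply: C1B; [exact: C1_coord|exact: C1_cst].
Qed.

Lemma bump_ge0 z r x : 0 <= bump z r x.
Proof. by apply: prodr_ge0 => i _; exact: sqr_pos_ge0. Qed.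

Lemma bump_le1 z r x : bump z r x <= 1.
Proof.
apply: Num.Theory.prodr_ile1 => i _; rewrite sqr_pos_ge0 sqr_pos_le1//.
by rewrite lerBlDr lerDl sqr_ge0.
Qed.

Lemma bump_factor_gt0 (r t : R) : 0 < r ->
  (0 < 1 - (t * r^-1) ^+ 2) = (`|t| < r).
Proof.
move=> r0; rewrite subr_gt0 -real_normK ?num_real// expr_lt1//.
by rewrite normrM normfV (gtr0_norm r0) ltr_pdivrMr// mul1r.
Qed.

Lemma bump_gt0 z r x : 0 < r -> `|x - z| < r -> 0 < bump z r x.
Proof.
move=> r0 xz; apply: prodr_gt0 => i _; rewrite sqr_pos_gt0 bump_factor_gt0//.
by apply: le_lt_trans xz; have := coord_le_norm (x - z) i; rewrite !mxE.
Qed.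

Lemma bump_eq0 z r x : 0 < r -> r <= `|x - z| -> bump z r x = 0.
Proof.
move=> r0 rxz; apply/eqP; rewrite prodf_seq_eq0/=; apply/hasP.
have [i ri] : exists i, r <= `|(x - z) ord0 i|.
  apply: contrapT => /forallNP H; move: rxz; rewrite leNgt => /negP; apply.
  rewrite [ltLHS]/Num.Def.normr /= mx_normrE; apply/bigmax_ltP; split => //=.
  by move=> [j i] _ /=; rewrite ord1 ltNge; apply/negP; exact: H.
exists i; first by rewrite mem_index_enum.
rewrite /= eq_le sqr_pos_ge0 andbT leNgt sqr_pos_gt0 bump_factor_gt0//.
by rewrite -leNgt; move: ri; rewrite !mxE.
Qed.

(** Each factor is 1 when the coordinate is at most M in absolute value and
    vanishes when it is at least M + 1. *)
Definition cutoff (M : R) x : R :=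
  \prod_(i < n) sqr_pos (1 - (sqr_pos (x ord0 i - M) + sqr_pos (- x ord0 i - M))).

Lemma C1_cutoff M : C1 (cutoff M).
Proof.
apply: C1_prod => i; apply: C1_sqr_pos; apply: C1B; first exact: C1_cst.
apply: C1D; apply: C1_sqr_pos.
  by apply: C1B; [exact: C1_coord|exact: C1_cst].
by apply: C1B; [apply: C1N; exact: C1_coord|exact: C1_cst].
Qed.

Lemma cutoff_itv M x : 0 <= cutoff M x <= 1.
Proof.
rewrite prodr_ge0/=; last by move=> i _; exact: sqr_pos_ge0.
apply: Num.Theory.prodr_ile1 => i _; rewrite sqr_pos_ge0 sqr_pos_le1//.
by rewrite lerBlDr lerDl addr_ge0// sqr_pos_ge0.
Qed.

Lemma sqr_pos_eq0 (t : R) : t <= 0 -> sqr_pos t = 0.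
Proof. by rewrite /sqr_pos maxEle => ->; rewrite expr0n. Qed.

Lemma cutoff_eq1 M x : `|x| <= M -> cutoff M x = 1.
Proof.
move=> xM; rewrite /cutoff big1// => i _.
have := le_trans (coord_le_norm x i) xM; rewrite ler_norml => /andP[h1 h2].
rewrite (@sqr_pos_eq0 (x ord0 i - M)) ?subr_le0//.
rewrite (@sqr_pos_eq0 (- x ord0 i - M)) ?subr_le0; last lra.
by rewrite addr0 subr0 /sqr_pos maxEle leNgt ltr01/= expr1n.
Qed.

Lemma cutoff_eq0 M x : 0 <= M -> M + 1 < `|x| -> cutoff M x = 0.
Proof.
move=> M0 Mx; apply/eqP; rewrite prodf_seq_eq0/=; apply/hasP.
have [i ri] : exists i, M + 1 < `|x ord0 i|.
  apply: contrapT => /forallNP H; move: Mx; rewrite ltNge => /negP; apply.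
  apply: norm_le_coord => [|i]; first lra.
  by rewrite leNgt; apply/negP; exact: H.
exists i; first by rewrite mem_index_enum.
have sge (t : R) : 1 <= t -> 1 <= sqr_pos t.
  by rewrite /sqr_pos maxEle; case: ifPn => ? ?; nra.
rewrite sqr_pos_eq0//= subr_le0.
have h1 := sqr_pos_ge0 (x ord0 i - M); have h2 := sqr_pos_ge0 (- x ord0 i - M).
move: ri; rewrite lter_normr => /orP[ri|ri].
  have : 1 <= sqr_pos (x ord0 i - M) by apply: sge; lra.
  lra.
have : 1 <= sqr_pos (- x ord0 i - M) by apply: sge; lra.
lra.
Qed.

(** Dominated convergence, dominated by a multiple of the weight. *)
Lemma small_int_of_cvg w (psi_ : nat -> 'rV[R]_n -> R) psi (e : R) :
  bbs w -> (forall k, measurable_fun setT (psi_ k)) ->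
  (forall k x, `|psi_ k x| <= 1) ->
  (forall x, psi_ k x @[k --> \oo] --> psi x) -> 0 < e ->
  exists k, \int[mu]_x (`|w x| * `|psi x - psi_ k x|) <= e.
Proof.
move=> bw mpsi psi1 psic e0.
have mp : measurable_fun setT psi.
  by apply: (measurable_fun_cvg mpsi) => x _; exact: psic.
have p1 x : `|psi x| <= 1.
  apply: (cvgr_to_le (cvg_norm (psic x))).
  by apply: nearW => k; exact: psi1.
have bk k : bbs (fun x => `|w x| * `|psi x - psi_ k x|).
  apply: (@bbsMb _ _ _ _ 2); first exact: bbs_norm.
    by apply: measurableT_comp => //; exact: measurable_funB.
  move=> x; rewrite normr_id; apply: le_trans (ler_normB _ _) _.
  by rewrite -[2]/(1 + 1) lerD.
have C : (\int[mu]_x (`|w x| * `|psi x - psi_ k x|)%:E)%E @[k --> \oo] -->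
    (\int[mu]_(x in setT) (cst 0 x))%E.
  apply: (@dominated_cvg _ _ _ mu setT measurableT
    (fun k x => (`|w x| * `|psi x - psi_ k x|)%:E) (cst 0%E)
    (fun x => (2 * `|w x|)%:E)) => //.
  - move=> k; apply/measurable_EFinP; exact: (proj1 (bk k)).
  - move=> x _; apply: cvg_EFin; first exact: nearW.
    have H : `|w x| * `|psi x - psi_ k x| @[k --> \oo] --> `|w x| * `|psi x - psi x|.
      apply: cvgM; first exact: cvg_cst.
      by apply: cvg_norm; apply: cvgB; [exact: cvg_cst|exact: psic].
    by move: H; rewrite subrr normr0 mulr0.
  - exact: (bbs_integrable (bbsZ 2 (bbs_norm bw))).
  - move=> k x _; rewrite /= lee_fin normrM !normr_id mulrC ler_wpM2r//.
    apply: le_trans (ler_normB _ _) _.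
    by rewrite -[2]/(1 + 1) lerD.
rewrite integral0 in C.
have /fine_cvgP[_ /cvgr0_norm_le /(_ _ e0) [k _ H]] := C.
exists k; have := H k (leqnn k); rewrite /= ger0_norm//.
by apply: fine_ge0; apply: integral_ge0 => x _; rewrite lee_fin mulr_ge0.
Qed.

End density.
(** * Approximation of Borel sets by C1 functions *)

Section approximation_of_indicators.
Context {R : realType} {n : nat}.
Local Notation mu := (lebesgue_rV n).
Implicit Types (f g w phi : 'rV[R]_n -> R) (A B E : set 'rV[R]_n) (x y z : 'rV[R]_n).

Definition approximable w A : Prop := measurable A /\
  forall e : R, 0 < e -> exists phi, [/\ C1 phi, forall x, 0 <= phi x <= 1 &
    \int[mu]_x (`|w x| * `|\1_A x - phi x|) <= e].

Lemma indic_itv A x : 0 <= (\1_A x : R) <= 1.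
Proof. by rewrite indicE; case: (_ \in _); rewrite /= ?lexx ler01. Qed.

Lemma bbs_weighted_dist w f g : bbs w ->
  measurable_fun setT f -> measurable_fun setT g ->
  (forall x, 0 <= f x <= 1) -> (forall x, 0 <= g x <= 1) ->
  bbs (fun x => `|w x| * `|f x - g x|).
Proof.
move=> bw mf mg f01 g01; apply: (@bbsMb _ _ _ _ 1); first exact: bbs_norm.
  by apply: measurableT_comp => //; exact: measurable_funB.
move=> x; rewrite normr_id ler_norml.
by have /andP[? ?] := f01 x; have /andP[? ?] := g01 x; apply/andP; split; lra.
Qed.

Variable w : 'rV[R]_n -> R.
Hypothesis bw : bbs w.

Lemma approximableC A : approximable w A -> approximable w (~` A).
Proof.
move=> [mA Aphi]; split; first exact: measurableC.
move=> e /Aphi[phi [phi1 phi01 phie]].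
exists (fun x => 1 - phi x); split.
- by apply: C1B => //; exact: C1_cst.
- by move=> x; have /andP[? ?] := phi01 x; apply/andP; split; lra.
- apply: le_trans phie; rewrite le_eqVlt; apply/orP; left; apply/eqP.
  apply: eq_Rintegral => x _; congr (_ * _).
  have -> : \1_(~` A) x = 1 - \1_A x :> R.
    by rewrite !indicE in_setC; case: (_ \in _); rewrite /= ?subr0 ?subrr.
  rewrite -[RHS]normrN; congr (`|_|); ring.
Qed.

Lemma approximableU A B :
  approximable w A -> approximable w B -> approximable w (A `|` B).
Proof.
move=> [mA Aphi] [mB Bpsi]; split; first exact: measurableU.
move=> e e0; have e20 : 0 < e / 2 by rewrite divr_gt0.
have [phi [phi1 phi01 phie]] := Aphi _ e20.
have [psi [psi1 psi01 psie]] := Bpsi _ e20.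
have cphi := continuous_measurable_rV (C1_continuous phi1).
have cpsi := continuous_measurable_rV (C1_continuous psi1).
exists (fun x => phi x + psi x - phi x * psi x); split.
- by apply: C1B; [exact: C1D|exact: C1M].
- move=> x; have /andP[? ?] := phi01 x; have /andP[? ?] := psi01 x.
  by apply/andP; split; nra.
- rewrite [leRHS](splitr e); apply: le_trans (lerD phie psie).
  rewrite -intD; [|exact: bbs_weighted_dist (indic_itv A) phi01|
                   exact: bbs_weighted_dist (indic_itv B) psi01].
  apply: le_int.
  + apply: bbs_weighted_dist => //.
    * by apply: measurable_indic; exact: measurableU.
    * by apply: measurable_funB; [exact: measurable_funD|exact: measurable_funM].
    * exact: indic_itv.
    * move=> x; have /andP[? ?] := phi01 x; have /andP[? ?] := psi01 x.
      by apply/andP; split; nra.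
  + by apply: bbsD; apply: bbs_weighted_dist => //; exact: indic_itv.
  + move=> x; rewrite -mulrDr ler_wpM2l//.
    have -> : \1_(A `|` B) x = \1_A x + \1_B x - \1_A x * \1_B x :> R.
      rewrite !indicE in_setU.
      by do 2 case: (_ \in _); rewrite /=; ring.
    have /andP[p0 p1] := phi01 x; have /andP[q0 q1] := psi01 x.
    have /andP[a0 a1] := indic_itv A x; have /andP[b0 b1] := indic_itv B x.
    set a := \1_A x : R in a0 a1 *; set b := \1_B x : R in b0 b1 *.
    set p := phi x in p0 p1 *; set q := psi x in q0 q1 *.
    have -> : a + b - a * b - (p + q - p * q) = (a - p) * (1 - b) + (b - q) * (1 - p).
      by ring.
    apply: le_trans (ler_normD _ _) _; rewrite !normrM.
    apply: lerD; apply: ler_piMr => //; rewrite ger0_norm; lra.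
Qed.

Lemma approximable_lim (A_ : nat -> set 'rV[R]_n) A :
  (forall k, approximable w (A_ k)) ->
  (forall x, \1_(A_ k) x @[k --> \oo] --> (\1_A x : R)) ->
  measurable A -> approximable w A.
Proof.
move=> aA cA mA; split => // e e0; have e20 : 0 < e / 2 by rewrite divr_gt0.
have [] := @small_int_of_cvg R n w (fun k => \1_(A_ k)) \1_A (e / 2) bw _ _ cA e20.
- by move=> k; apply: measurable_indic; have [] := aA k.
- by move=> k x; rewrite ger0_norm; have /andP[] := indic_itv (A_ k) x.
move=> k ke; have [mAk /(_ _ e20)[phi [phi1 phi01 phie]]] := aA k.
have cphi := continuous_measurable_rV (C1_continuous phi1).
exists phi; split => //.
rewrite [leRHS](splitr e); apply: le_trans (lerD ke phie).
have b1 : bbs (fun x => `|w x| * `|\1_A x - \1_(A_ k) x|).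
  by apply: bbs_weighted_dist => //; exact: indic_itv.
have b2 : bbs (fun x => `|w x| * `|\1_(A_ k) x - phi x|).
  by apply: bbs_weighted_dist => //; exact: indic_itv.
rewrite -intD//; apply: le_int.
- by apply: bbs_weighted_dist => //; exact: indic_itv.
- exact: bbsD.
- by move=> x; rewrite -mulrDr ler_wpM2l// ler_distD.
Qed.

Lemma approximable0 : approximable w set0.
Proof.
split => // e e0; exists (fun=> 0); split.
- exact: C1_cst.
- by move=> x; rewrite lexx ler01.
- under eq_Rintegral do rewrite indic0 subrr normr0 mulr0.
  by rewrite Rintegral_cst// mul0r ltW.
Qed.

Lemma approximable_bigcup (A_ : nat -> set 'rV[R]_n) :
  (forall k, approximable w (A_ k)) -> approximable w (\bigcup_k A_ k).
Proof.
move=> aA; apply: (@approximable_lim (fun k => \big[setU/set0]_(i < k) A_ i)).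
- move=> k; elim: k => [|k IHk]; first by rewrite big_ord0; exact: approximable0.
  by rewrite big_ord_recr; exact: approximableU.
- move=> x; have [[k _ Ak]|nA] := pselect ((\bigcup_k A_ k) x).
    rewrite [in X in _ --> X]indicE mem_set; last by exists k.
    apply: cvg_near_cst; exists k.+1 => // l /= kl.
    rewrite indicE mem_set// -bigcup_mkord; exists k => //.
  rewrite [in X in _ --> X]indicE memNset//.
  apply: cvg_near_cst; apply: nearW => l.
  rewrite indicE memNset// -bigcup_mkord => -[i _ Ai]; apply: nA.
  by exists i.
- by apply: bigcupT_measurable => k; have [] := aA k.
Qed.

(** The functions 1 - (1 - b)^k, with b the bump of the ball, increase to the
    indicator of the ball. *)
Lemma approximable_ball z (r : R) : 0 < r -> approximable w (ball z r).
Proof.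
move=> r0; have mb : measurable (ball z r).
  by apply: open_measurable_rV; exact: ball_open.
split => // e e0.
have p01 k x : 0 <= 1 - (1 - bump z r x) ^+ k <= 1.
  have h0 := bump_ge0 z r x; have h1 := bump_le1 z r x.
  have : 0 <= (1 - bump z r x) ^+ k by rewrite exprn_ge0//; lra.
  have : (1 - bump z r x) ^+ k <= 1 by rewrite exprn_ile1//; lra.
  by move=> ? ?; apply/andP; split; lra.
have C k : C1 (fun x => 1 - (1 - bump z r x) ^+ k).
  apply: C1B; first exact: C1_cst.
  by apply: C1X; apply: C1B; [exact: C1_cst|exact: C1_bump].
have [] := @small_int_of_cvg R n w (fun k x => 1 - (1 - bump z r x) ^+ k.+1)
  \1_(ball z r) e bw _ _ _ e0.
- by move=> k; apply: continuous_measurable_rV; exact: C1_continuous.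
- by move=> k x; have /andP[? ?] := p01 k.+1 x; rewrite ger0_norm.
- move=> x; have [xb|nb] := pselect (ball z r x).
    rewrite [in X in _ --> X]indicE mem_set//= -[X in _ --> X]subr0.
    apply: cvgB; first exact: cvg_cst.
    have b0 : 0 < bump z r x.
      by apply: bump_gt0 => //; move: xb; rewrite -ball_normE/= distrC.
    have b1 := bump_le1 z r x.
    apply: (@cvg_trans _ ((fun k => (1 - bump z r x) ^+ k) @ \oo)).
      by rewrite cvg_shiftS.
    by apply: cvg_expr; rewrite ger0_norm; lra.
  rewrite [in X in _ --> X]indicE memNset//=.
  apply: cvg_near_cst; apply: nearW => k.
  rewrite bump_eq0 ?subr0 ?expr1n ?subrr//.
  by move: nb; rewrite -ball_normE/= distrC => /negP; rewrite -leNgt.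
- by move=> k ke; exists (fun x => 1 - (1 - bump z r x) ^+ k.+1); split.
Qed.

Lemma approximable_open A : open A -> approximable w A.
Proof.
move=> oA; rewrite (open_rV_bigcup_ball oA) bigcup_mkcond.
pose F (p : 'rV[rat]_n * nat) : set 'rV[R]_n :=
  if p \in [set p : 'rV[rat]_n * nat |
         ball (map_mx ratr p.1 : 'rV[R]_n) p.2.+1%:R^-1 `<=` A]
  then ball (map_mx ratr p.1 : 'rV[R]_n) p.2.+1%:R^-1 else set0.
rewrite (_ : bigcup _ _ = \bigcup_k (if unpickle k is Some p then F p else set0)).
  apply: approximable_bigcup => k; case: unpickle => [p|]; last exact: approximable0.
  rewrite /F; case: ifPn => _; last exact: approximable0.
  exact: approximable_ball.
apply/seteqP; split => x [p _ Fp].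
  by exists (pickle p) => //; rewrite pickleK.
by case: unpickle Fp => // q Fq; exists q.
Qed.

(** The approximable sets form a sigma-algebra: use 1 - phi for the complement,
    phi + psi - phi psi for the union, and dominated convergence to pass from
    finite to countable unions. It contains the balls, hence the open sets. *)
Lemma approximable_measurable A : measurable A -> approximable w A.
Proof.
apply: smallest_sub; last by move=> U; exact: approximable_open.
split; first exact: approximable0.
- by move=> B aB; rewrite setTD; exact: approximableC.
- exact: approximable_bigcup.
Qed.

End approximation_of_indicators.

(** * Translations and the perimeter *)

Section translation_estimate.
Context {R : realType} {n : nat}.
Local Notation mu := (lebesgue_rV n).
Implicit Types (f g w phi : 'rV[R]_n -> R) (A B E : set 'rV[R]_n) (x y z : 'rV[R]_n).

Lemma corr_shiftE E phi z : bbs (\1_E : 'rV[R]_n -> R) -> continuous phi ->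
  corr \1_E phi z = \int[mu]_y (\1_E (y + z) * phi y).
Proof.
move=> bE cphi; rewrite /corr -(int_shift z (bbs_corr z bE cphi)).
by apply: eq_Rintegral => y _; rewrite addrK.
Qed.

(** Let f be the integrand without the absolute value and A the set where f is
    positive. As f takes the values -1, 0 and 1 only, its absolute value is
    f (2 1_A - 1). After a C1 approximation of 1_A, the integral of
    f (2 1_A - 1) becomes a difference of two values of a correlation of 1_E
    with a test function, whose partial derivatives are bounded by p. *)
Lemma translation_estimate E p z : measurable E ->
  bbs (\1_E : 'rV[R]_n -> R) -> perimeter_bound E p ->
  \int[mu]_y `|\1_E (y + z) - \1_E y| <= p * n%:R * `|z|.
Proof.
move=> mE bE Ep.
pose f y : R := \1_E (y + z) - \1_E y.
have bEz : bbs (fun y => \1_E (y + z) : R) by exact: bbs_shift.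
have bf : bbs f by apply: bbsB.
pose A := [set y | 0 < f y].
have mA : measurable A.
  rewrite -[A]setTI; have [mf _] := bf.
  rewrite (_ : A = f @^-1` `]0, +oo[).
    exact: (mf measurableT _ (measurable_itv _)).
  by apply/seteqP; split => y /=; rewrite /A/= in_itv/= andbT.
have [_ [M fM]] := bf.
have M0 : 0 <= M by apply: le_trans (proj1 (fM 0)).
apply/ler_addgt0Pr => e e0.
have e20 : 0 < e / 2 by rewrite divr_gt0.
have [_ /(_ _ e20)[phi [phi1 phi01 phie]]] := approximable_measurable bf mA.
have cphi := C1_continuous phi1.
(* The cut-off makes 2 phi - 1 compactly supported without changing it where
   f is nonzero. *)
pose psi y := cutoff M y * (phi y + phi y - 1).
have psi1 : C1 psi.
  apply: C1M; first exact: C1_cutoff.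
  by apply: C1B; [exact: C1D|exact: C1_cst].
have psiB y : M + 1 < `|y| -> psi y = 0.
  by move=> My; rewrite /psi cutoff_eq0 ?mul0r.
have psile y : `|psi y| <= 1.
  rewrite /psi normrM; apply: mulr_ile1 => //.
    by have /andP[? ?] := cutoff_itv M y; rewrite ger0_norm.
  by have /andP[? ?] := phi01 y; rewrite ler_norml; apply/andP; split; lra.
have cpsi := C1_continuous psi1.
have bfpsi : bbs (fun y => f y * psi y) by exact: bbsM.
have bd : bbs (fun y => `|f y| * `|\1_A y - phi y|).
  apply: bbs_weighted_dist => //.
  - exact: continuous_measurable_rV.
  - by move=> x; exact: indic_itv.
have step1 : \int[mu]_y `|f y| <=
    \int[mu]_y (f y * psi y) + (\int[mu]_y (`|f y| * `|\1_A y - phi y|) +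
      \int[mu]_y (`|f y| * `|\1_A y - phi y|)).
  rewrite -intD// -intD//; last exact: bbsD.
  apply: le_int; first exact: bbs_norm.
    by apply: bbsD => //; exact: bbsD.
  move=> y; have [yM|My] := leP `|y| M; last first.
    by rewrite (proj2 (fM y) My) normr0 !mul0r !addr0.
  rewrite /psi cutoff_eq1// mul1r.
  have E1 : `|f y| = f y * (\1_A y + \1_A y - 1).
    rewrite indicE; case: (boolP (y \in A)) => [|].
      by rewrite inE => /ltW fy0; rewrite ger0_norm//= addrK mulr1.
    rewrite notin_setE /A/= => /negP; rewrite -leNgt => fy0.
    by rewrite ler0_norm//= add0r sub0r mulrN1.
  rewrite [leLHS]E1 -lerBlDl -mulrBr -mulrDr.
  apply: le_trans (ler_norm _) _; rewrite normrM ler_wpM2l//.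
  have -> : \1_A y + \1_A y - 1 - (phi y + phi y - 1) = (\1_A y - phi y) + (\1_A y - phi y).
    by ring.
  exact: ler_normD.
apply: (le_trans step1); apply: lerD; last by rewrite [leRHS](splitr e) lerD.
have -> : \int[mu]_y (f y * psi y) = corr \1_E psi z - corr \1_E psi 0.
  rewrite !corr_shiftE// -intB; [|exact: bbsM|exact: bbsM (bbs_shift 0 bE) cpsi].
  by apply: eq_Rintegral => y _; rewrite addr0 mulrBl.
apply: le_trans (ler_norm _) _.
have K : forall x i, `|'D_(delta_mx ord0 i) (corr \1_E psi) x| <= p.
  by move=> x i; exact: (int_corr_derive_le i x bE Ep psi1 psiB psile).
by have := C1_lipschitz (C1_corr bE psi1) K 0 z; rewrite subr0.
Qed.

End translation_estimate.
(** * Fubini for bounded functions with bounded support *)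

Section fubini_bounded_support.
Context {R : realType} {n : nat}.
Local Notation mu := (lebesgue_rV n).
Variables (F : 'rV[R]_n -> 'rV[R]_n -> R) (C M : R).
Hypothesis mF : measurable_fun setT (fun p : 'rV[R]_n * 'rV[R]_n => F p.1 p.2).
Hypothesis FC : forall x z, `|F x z| <= C.
Hypothesis F1 : forall x z, M < `|x| -> F x z = 0.
Hypothesis F2 : forall x z, M < `|z| -> F x z = 0.

Lemma bbs_section1 x : bbs (F x).
Proof.
apply: (@bbsI _ _ _ C M) => // [|z]; last exact: F2.
exact: (measurable_pair2 x mF) || exact: (measurableT_comp mF (measurable_pair1 x)).
Qed.

Lemma bbs_section2 z : bbs (F ^~ z).
Proof.
apply: (@bbsI _ _ _ C M) => // [|x]; last exact: F1.
exact: (measurableT_comp mF (measurable_pair2 z)).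
Qed.

Let C0 : 0 <= C.
Proof. by apply: le_trans (FC 0 0). Qed.

Let mcube : measurable (@cube R n M).
Proof. exact: measurable_norm_le. Qed.

Let bcube : bbs (\1_(cube M) : 'rV[R]_n -> R).
Proof.
apply: bbs_indic => //; exists M; split; first exact: num_real.
by move=> N MN y /= yM; rewrite (le_trans yM)// ltW.
Qed.

Let inner_le x : \int[mu]_z `|F x z| <= C * fine (mu (cube M)).
Proof.
rewrite -(int_indic mcube) -intZ//; apply: le_int.
- exact: bbs_norm (bbs_section1 x).
- exact: bbsZ.
- move=> z; rewrite indicE; case: (boolP (z \in _)) => [_|].
    by rewrite mulr1.
  by rewrite notin_setE /cube/= => /negP; rewrite -ltNge => /F2 ->; rewrite normr0 mulr0.
Qed.

Let integrableF : (mu \x mu)%E.-integrable setT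
  (fun p : 'rV[R]_n * 'rV[R]_n => (F p.1 p.2)%:E).
Proof.
apply/(@integrable12ltyP _ _ _ _ R mu mu); first exact/measurable_EFinP.
pose D := C * fine (mu (cube M)).
have D0 : 0 <= D by rewrite mulr_ge0// fine_ge0.
have bD : bbs (fun x : 'rV[R]_n => D * \1_(cube M) x).
  exact: bbsZ bcube.
apply: (@le_lt_trans _ _ (\int[mu]_x (D * \1_(cube M) x)%:E)%E).
  apply: ge0_le_integral => //.
  - by move=> x _; apply: integral_ge0.
  - apply: (measurable_fun_fubini_tonelli_F
      (fun p : 'rV[R]_n * 'rV[R]_n => (`|(F p.1 p.2)%:E|)%E)) => //=.
    by apply/measurable_EFinP; apply: (@measurableT_comp _ _ _ _ _ _ (fun r : R => `|r|)).
  - by apply/measurable_EFinP; have [] := bD.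
  - move=> x _; rewrite /= -(EFin_int (bbs_norm (bbs_section1 x))) lee_fin.
    rewrite indicE; case: (boolP (x \in _)) => [_|].
      by rewrite mulr1; exact: inner_le.
    rewrite notin_setE /cube/= => /negP; rewrite -ltNge => Mx.
    rewrite mulr0; under eq_Rintegral do rewrite F1// normr0.
    by rewrite Rintegral_cst// mul0r.
by rewrite -EFin_int// ltry.
Qed.

Lemma bbs_int_section1 : bbs (fun x => \int[mu]_z F x z).
Proof.
apply: (@bbsI _ _ _ (C * fine (mu (cube M))) M).
- have := measurable_fubini_F integrableF.
  move=> mf; apply/measurable_EFinP; apply: eq_measurable_fun mf => x _.
  by rewrite /= /fubini_F EFin_int//; exact: bbs_section1.
- move=> x; apply: le_trans (inner_le x).
  exact: norm_int_le (bbs_section1 x).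
- move=> x Mx; under eq_Rintegral do rewrite F1//.
  by rewrite Rintegral_cst// mul0r.
Qed.

Lemma bbs_int_section2 : bbs (fun z => \int[mu]_x F x z).
Proof.
apply: (@bbsI _ _ _ (C * fine (mu (cube M))) M).
- have := measurable_fubini_G integrableF.
  move=> mf; apply/measurable_EFinP; apply: eq_measurable_fun mf => z _.
  by rewrite /= /fubini_G EFin_int//; exact: bbs_section2.
- move=> z; apply: le_trans (norm_int_le (bbs_section2 z)) _.
  rewrite -(int_indic mcube) -intZ//.
  apply: le_int.
  + exact: bbs_norm (bbs_section2 z).
  + exact: bbsZ bcube.
  + move=> x; rewrite indicE; case: (boolP (x \in _)) => [_|].
      by rewrite mulr1.
    by rewrite notin_setE /cube/= => /negP; rewrite -ltNge => /F1 ->; rewrite normr0 mulr0.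
- move=> z Mz; under eq_Rintegral do rewrite F2//.
  by rewrite Rintegral_cst// mul0r.
Qed.

Lemma int_fubini :
  \int[mu]_x (\int[mu]_z F x z) = \int[mu]_z (\int[mu]_x F x z).
Proof.
have := Fubini integrableF => /=.
rewrite /Rintegral -/(Rintegral _ _ _) => H; congr fine.
transitivity (\int[mu]_x \int[mu]_z (F x z)%:E)%E.
  by apply: eq_integral => x _; rewrite -EFin_int//; exact: bbs_section1.
rewrite H; apply: eq_integral => z _.
by rewrite -EFin_int//; exact: bbs_section2.
Qed.

End fubini_bounded_support.

(** * Mollification of sets *)

Section mollification.
Context {R : realType} {n : nat}.
Local Notation mu := (lebesgue_rV n).
Implicit Types (f g w phi rho : 'rV[R]_n -> R) (A B E : set 'rV[R]_n) (x y z : 'rV[R]_n).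

Definition mollifier (e : R) rho : Prop := [/\ C1 rho, forall x, 0 <= rho x,
  forall x, e < `|x| -> rho x = 0 & \int[mu]_x rho x = 1].

Lemma mollifier_exists (e : R) : 0 < e -> exists rho, mollifier e rho.
Proof.
move=> e0; pose b := @bump R n 0 e.
have b1 : C1 b by exact: C1_bump.
have be x : e < `|x| -> b x = 0.
  by move=> /ltW ex; apply: bump_eq0 => //; rewrite subr0.
have bb : bbs b by apply: (bbs_cts (C1_continuous b1) be).
pose Q := cube (e / 2) : set 'rV[R]_n.
have mQ : measurable Q by exact: measurable_norm_le.
have bQ : bbs (\1_Q : 'rV[R]_n -> R).
  apply: bbs_indic => //; exists (e / 2); split; first exact: num_real.
  by move=> N MN y /= yM; rewrite (le_trans yM)// ltW.
pose c : R := \prod_(i < n) (4^-1).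
have c0 : 0 < c by apply: prodr_gt0.
have Q0 : 0 < fine (mu Q).
  have := @lebesgue_rV_box R n (const_mx (- (e / 2))) (const_mx (e / 2)).
  rewrite (_ : [set v | _] = Q).
    move=> ->; last by move=> i; rewrite !mxE; lra.
    by apply: prodr_gt0 => i _; rewrite !mxE; lra.
  apply/seteqP; split => [x xM|x xM i] /=.
    apply: norm_le_coord => [|i]; first lra.
    by have := xM i; rewrite !mxE ler_norml.
  by rewrite !mxE -ler_norml (le_trans (coord_le_norm x i)).
pose I := \int[mu]_x b x.
have I0 : 0 < I.
  apply: (@lt_le_trans _ _ (c * fine (mu Q))); first exact: mulr_gt0.
  rewrite -(int_indic mQ) -intZ//; apply: le_int => //; first exact: bbsZ.
  move=> x; rewrite indicE; case: (boolP (x \in Q)) => [|_].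
    rewrite inE /Q/cube/= mulr1 => xe; apply: ler_prod => i _.
    rewrite invr_ge0 ler0n/= mxE subr0.
    have xi := le_trans (coord_le_norm x i) xe.
    have : ((x ord0 i) / e) ^+ 2 <= 4^-1.
      rewrite -real_normK ?num_real// normrM normfV (gtr0_norm e0).
      have : `|x ord0 i| / e <= 2^-1 by rewrite ler_pdivrMr// mulrC.
      have : 0 <= `|x ord0 i| / e by rewrite divr_ge0// ltW.
      by set t := _ / e; nra.
    rewrite /sqr_pos maxEle; set t := (_ / e) ^+ 2 => t4.
    have -> : (1 - t <= 0) = false by apply/negbTE; rewrite -ltNge; lra.
    by nra.
  by rewrite mulr0; exact: bump_ge0.
exists (fun x => I^-1 * b x); split.
- by apply: C1M => //; exact: C1_cst.
- by move=> x; rewrite mulr_ge0 ?invr_ge0 ?(ltW I0)//; exact: bump_ge0.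
- by move=> x /be ->; rewrite mulr0.
- by rewrite intZ// mulVf// gt_eqF.
Qed.

Section mollified_indicator.
Variables (e : R) (rho : 'rV[R]_n -> R).
Hypothesis e0 : 0 < e.
Hypothesis rhoP : mollifier e rho.
Variable E : set 'rV[R]_n.
Hypothesis mE : measurable E.
Hypothesis bE : bbs (\1_E : 'rV[R]_n -> R).

Let rho1 : C1 rho. Proof. by have [] := rhoP. Qed.
Let rho0 x : 0 <= rho x. Proof. by have [] := rhoP. Qed.
Let rhoe x : e < `|x| -> rho x = 0. Proof. by have [_ _ H _] := rhoP; exact: H. Qed.
Let intrho : \int[mu]_x rho x = 1. Proof. by have [] := rhoP. Qed.
Let crho : continuous rho. Proof. exact: C1_continuous. Qed.
Let brho : bbs rho. Proof. exact: bbs_cts crho rhoe. Qed.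

Local Notation u := (corr \1_E rho).

Lemma mollifiedE x : u x = \int[mu]_z (rho z * \1_E (x + z)).
Proof.
rewrite corr_shiftE//; apply: eq_Rintegral => z _.
by rewrite mulrC addrC.
Qed.

Let brE x : bbs (fun z => rho z * \1_E (x + z)).
Proof.
apply: (@bbsMb _ _ _ _ 1) => //.
  under eq_fun do rewrite addrC.
  by have [] := bbs_shift x bE.
move=> z; have /andP[? ?] := @indic_itv R n E (x + z).
by rewrite ger0_norm.
Qed.

Lemma mollified_itv x : 0 <= u x <= 1.
Proof.
rewrite mollifiedE int_ge0/=; last first.
  by move=> z; rewrite mulr_ge0//; have /andP[] := @indic_itv R n E (x + z).
rewrite -intrho; apply: le_int => // z.
by rewrite ler_piMr//; have /andP[] := @indic_itv R n E (x + z).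
Qed.

Lemma mollified_C1 : C1 u.
Proof. exact: C1_corr. Qed.

Lemma mollified_out : exists B : R, forall x, B < `|x| -> u x = 0.
Proof.
have [_ [M EM]] := bE; exists (M + e) => x Mx.
rewrite (_ : corr _ _ _ = \int[mu]_(y in setT) 0); first by rewrite Rintegral_cst// mul0r.
apply: eq_Rintegral => y _; have [yM|My] := leP `|y| M; last by rewrite (proj2 (EM y)) ?mul0r.
rewrite rhoe ?mulr0//.
have := ler_normB y (y - x); rewrite opprB addrCA subrr addr0; lra.
Qed.

Lemma bbs_mollified : bbs u.
Proof.
have [B uB] := mollified_out.
exact: bbs_cts (C1_continuous mollified_C1) uB.
Qed.

Lemma mollified_le_mass (K : R) x : (forall y, rho y <= K) ->
  u x <= K * fine (mu E).
Proof.
move=> rK; rewrite -(int_indic mE) -intZ//; apply: le_int.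
- exact: bbs_corr.
- exact: bbsZ.
- by move=> y; rewrite mulrC ler_wpM2r.
Qed.

Lemma mollified_lipschitz (L : R) x x' :
  (forall y y', `|rho y' - rho y| <= L * `|y' - y|) ->
  `|u x' - u x| <= L * fine (mu E) * `|x' - x|.
Proof.
move=> rL; rewrite /corr -intB; [|exact: bbs_corr..].
apply: le_trans (norm_int_le _) _; first by apply: bbsB; exact: bbs_corr.
rewrite mulrAC -(int_indic mE) -intZ//; apply: le_int.
- by apply: bbs_norm; apply: bbsB; exact: bbs_corr.
- exact: bbsZ.
- move=> y; rewrite -mulrBr normrM mulrC.
  have /andP[i0 i1] := @indic_itv R n E y.
  rewrite (ger0_norm i0) ler_wpM2r//.
  apply: le_trans (rL _ _) _.
  by rewrite opprB addrC addrA subrK distrC.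
Qed.

Lemma measurable_add_pair : measurable_fun setT
  (fun p : 'rV[R]_n * 'rV[R]_n => p.1 + p.2).
Proof.
apply: measurable_fun_rV => i; under eq_fun do rewrite !mxE.
apply: measurable_funD.
  exact: (measurableT_comp (measurable_coord_rV i) measurable_fst).
exact: (measurableT_comp (measurable_coord_rV i) measurable_snd).
Qed.

Let mf1 f : measurable_fun setT f ->
  measurable_fun setT (fun p : 'rV[R]_n * 'rV[R]_n => f p.1).
Proof. by move=> mf; exact: (measurableT_comp mf measurable_fst). Qed.

Let mf2 f : measurable_fun setT f ->
  measurable_fun setT (fun p : 'rV[R]_n * 'rV[R]_n => f p.2).
Proof. by move=> mf; exact: (measurableT_comp mf measurable_snd). Qed.

Let mf12 f : measurable_fun setT f ->
  measurable_fun setT (fun p : 'rV[R]_n * 'rV[R]_n => f (p.1 + p.2)).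
Proof. by move=> mf; exact: (measurableT_comp mf measurable_add_pair). Qed.

(** By Fubini, the mollified indicator is an average of indicators of
    translates of E, and translating E amounts to translating the test field
    the other way. *)
Lemma mollified_perimeter_bound p (g : 'rV[R]_n -> 'rV[R]_n) : perimeter_bound E p -> test_field g ->
  \int[mu]_x (u x * divergence g x) <= p.
Proof.
move=> Ep tg; have bg := bbs_divergence tg.1.
have [mg [M gM]] := bg; have [mr [K rK]] := brho.
have mI : measurable_fun setT (\1_E : 'rV[R]_n -> R) by have [] := bE.
pose F x z := rho z * \1_E (x + z) * divergence g x.
have mF : measurable_fun setT (fun p : 'rV[R]_n * 'rV[R]_n => F p.1 p.2).
  apply: measurable_funM; last exact: (mf1 mg).
  by apply: measurable_funM; [exact: mf2|exact: mf12].
have FC x z : `|F x z| <= K * M.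
  rewrite /F !normrM; apply: ler_pM; rewrite ?mulr_ge0//; last by have [] := gM x.
  apply: le_trans (proj1 (rK z)); apply: ler_piMr => //.
  by have /andP[? ?] := @indic_itv R n E (x + z); rewrite ger0_norm.
have F1 x z : Num.max K M < `|x| -> F x z = 0.
  by rewrite gt_max => /andP[_ /(proj2 (gM x)) dx]; rewrite /F dx mulr0.
have F2 x z : Num.max K M < `|z| -> F x z = 0.
  by rewrite gt_max => /andP[/(proj2 (rK z)) rz _]; rewrite /F rz !mul0r.
have -> : \int[mu]_x (u x * divergence g x) = \int[mu]_x (\int[mu]_z F x z).
  apply: eq_Rintegral => x _; rewrite mollifiedE mulrC -intZ//.
  by apply: eq_Rintegral => z _; rewrite /F mulrC.
rewrite (int_fubini mF FC F1 F2).
have -> : p = \int[mu]_z (p * rho z) by rewrite intZ// intrho mulr1.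
apply: le_int; [exact: (bbs_int_section2 mF FC F1 F2)|exact: bbsZ|].
move=> z.
have tgz : test_field (fun x => g (x - z)).
  have [/C1c_fieldP[g1 [B gB]] gle] := tg.
  split; last by move=> x; exact: gle.
  apply/C1c_fieldP; split=> [i|]; first exact: (C1_shift (- z) (g1 i)).
  exists (B + `|z|) => x Bx; apply: gB.
  by have := ler_normD (x - z) z; rewrite subrK; lra.
have dE x : divergence (fun x => g (x - z)) (x + z) = divergence g x.
  rewrite /divergence; apply: eq_bigr => i _.
  by rewrite (derive_shift_rV (fun y => g y ord0 i)) addrK.
have bz : bbs (fun x => \1_E x * divergence (fun x => g (x - z)) x).
  by apply: bbs_indicM => //; exact: bbs_divergence tgz.1.
rewrite [leLHS](_ : _ = rho z * \int[mu]_x (\1_E x * divergence (fun x => g (x - z)) x)).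
  by rewrite [leRHS]mulrC ler_wpM2l//; exact: Ep.
rewrite -(int_shift z bz) -intZ; last exact: (bbs_shift z bz).
by apply: eq_Rintegral => x _; rewrite dE mulrA.
Qed.

(** Average the translation estimate over the support of the mollifier. *)
Lemma mollified_dist p : perimeter_bound E p ->
  \int[mu]_x `|u x - \1_E x| <= p * n%:R * e.
Proof.
move=> Ep; have p0 := perimeter_bound_ge0 Ep.
have [mr [K rK]] := brho; have [mI [M EM]] := bE.
pose G x z := rho z * `|\1_E (x + z) - \1_E x|.
have mG : measurable_fun setT (fun q : 'rV[R]_n * 'rV[R]_n => G q.1 q.2).
  apply: measurable_funM; first exact: mf2.
  apply: (@measurableT_comp _ _ _ _ _ _ (fun r : R => `|r|)) => //.
  by apply: measurable_funB; [exact: mf12|exact: mf1].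
have d1 x z : `|\1_E (x + z) - \1_E x| <= 1 :> R.
  have /andP[? ?] := @indic_itv R n E (x + z).
  have /andP[? ?] := @indic_itv R n E x.
  by rewrite ler_norml; apply/andP; split; lra.
have GC x z : `|G x z| <= K.
  rewrite /G normrM normr_id; apply: le_trans (proj1 (rK z)).
  by apply: ler_piMr => //; exact: d1.
have K0 : 0 <= K by apply: le_trans (proj1 (rK 0)).
have M0 : 0 <= M by apply: le_trans (proj1 (EM 0)).
have G2 x z : M + K < `|z| -> G x z = 0.
  by move=> Kz; rewrite /G (proj2 (rK z)) ?mul0r//; lra.
have G1 x z : M + K < `|x| -> G x z = 0.
  move=> MKx; have [zK|Kz] := leP `|z| K; last by rewrite /G (proj2 (rK z)) ?mul0r.
  rewrite /G (proj2 (EM (x + z))) ?(proj2 (EM x)) ?subrr ?normr0 ?mulr0//; first lra.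
  by have := ler_normB (x + z) z; rewrite addrK; lra.
have buE : bbs (fun x => u x - \1_E x) by apply: bbsB => //; exact: bbs_mollified.
apply: (@le_trans _ _ (\int[mu]_x (\int[mu]_z G x z))).
  apply: le_int; [exact: bbs_norm|exact: (bbs_int_section1 mG GC G1 G2)|].
  move=> x; have -> : u x - \1_E x = \int[mu]_z (rho z * (\1_E (x + z) - \1_E x)).
    rewrite mollifiedE -[in LHS](mulr1 (\1_E x)) -[in LHS]intrho -intZ// -intB//; last exact: bbsZ.
    by apply: eq_Rintegral => z _; rewrite mulrBr (mulrC (\1_E x)).
  apply: le_trans (norm_int_le _) _.
    under eq_fun do rewrite mulrBr (mulrC _ (\1_E x)).
    by apply: bbsB => //; exact: bbsZ.
  rewrite le_eqVlt; apply/orP; left; apply/eqP.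
  by apply: eq_Rintegral => z _; rewrite normrM (ger0_norm (rho0 z)).
rewrite (int_fubini mG GC G1 G2).
have -> : p * n%:R * e = \int[mu]_z (p * n%:R * e * rho z).
  by rewrite intZ// intrho mulr1.
apply: le_int; [exact: (bbs_int_section2 mG GC G1 G2)|exact: bbsZ|].
move=> z; rewrite mulrC intZ; last first.
  by apply: bbs_norm; apply: bbsB => //; exact: bbs_shift.
have [ze|ez] := leP `|z| e; last by rewrite rhoe// !mul0r.
rewrite ler_wpM2l//; apply: le_trans (translation_estimate z mE bE Ep) _.
by rewrite ler_wpM2l// mulr_ge0.
Qed.

End mollified_indicator.
End mollification.
(** * Submodularity of the perimeter *)

Section integration_by_parts.
Context {R : realType} {n : nat}.
Local Notation mu := (lebesgue_rV n).
Implicit Types (f phi : 'rV[R]_n -> R) (g : 'rV[R]_n -> 'rV[R]_n).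

Lemma bbs_C1M_coord f g i : continuous f -> C1c_field g ->
  bbs (fun x => f x * g x ord0 i).
Proof.
move=> cf gc; rewrite (_ : (fun _ => _) = (fun x => g x ord0 i * f x)).
  by apply: bbsM => //; exact: bbs_coord.
by apply/funext => x; rewrite mulrC.
Qed.

Lemma bbs_gradM_field f g : C1 f -> C1c_field g ->
  bbs (fun x => \sum_(i < n) 'D_(delta_mx ord0 i) f x * g x ord0 i).
Proof.
move=> f1 gc; apply: sum_bbs => i.
by apply: bbs_C1M_coord => //; have [] := f1 i.
Qed.

Lemma bbs_ctsM_div f g : continuous f -> C1c_field g ->
  bbs (fun x => f x * divergence g x).
Proof.
move=> cf gc; rewrite (_ : (fun _ => _) = (fun x => divergence g x * f x)).
  by apply: bbsM => //; exact: bbs_divergence.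
by apply/funext => x; rewrite mulrC.
Qed.

(** The sum over i of the i-th partial derivatives of f g_i integrates to 0. *)
Lemma integration_by_parts_div f g : C1 f -> C1c_field g ->
  \int[mu]_x (f x * divergence g x) =
  - \int[mu]_x (\sum_(i < n) 'D_(delta_mx ord0 i) f x * g x ord0 i).
Proof.
move=> f1 gc; have cf := C1_continuous f1.
have [g1 [B gB]] := (C1c_fieldP g).1 gc.
apply/eqP; rewrite -addr_eq0 -intD; [|exact: bbs_ctsM_div|exact: bbs_gradM_field].
have H i : C1 (fun x => f x * g x ord0 i) by exact: C1M.
have HB i x : B < `|x| -> f x * g x ord0 i = 0 by move=> /gB ->; rewrite mxE mulr0.
rewrite (_ : Rintegral _ _ _ =
  \int[mu]_x (\sum_(i < n) 'D_(delta_mx ord0 i) (fun x => f x * g x ord0 i) x)).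
  rewrite int_sum; last by move=> i; apply: (bbs_derive _ (H i) (HB i)).
  by rewrite big1// => i _; exact: (int_derive_eq0 _ (H i) (HB i)).
apply: eq_Rintegral => x _; rewrite /divergence mulr_sumr -big_split/=.
apply: eq_bigr => i _.
have := is_deriveM (is_derive_C1 i x f1) (is_derive_C1 i x (g1 i)).
move=> [_] ->.
by rewrite /GRing.scale/=; congr (_ + _); rewrite mulrC.
Qed.

End integration_by_parts.

Section submodularity.
Context {R : realType} {n : nat}.
Local Notation mu := (lebesgue_rV n).
Implicit Types (f phi : 'rV[R]_n -> R) (g : 'rV[R]_n -> 'rV[R]_n).
Implicit Types (E F : set 'rV[R]_n).

Lemma eucl_norm_le1 (v : 'rV[R]_n) :
  (eucl_norm v <= 1) = (\sum_(i < n) v ord0 i ^+ 2 <= 1).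
Proof.
have s0 : 0 <= \sum_(i < n) v ord0 i ^+ 2 by apply: sumr_ge0 => i _; exact: sqr_ge0.
by rewrite /eucl_norm -[X in _ <= X]sqrtr1 ler_sqrt.
Qed.

Lemma eucl_norm_convex (a b : 'rV[R]_n) (s : R) : 0 <= s <= 1 ->
  eucl_norm a <= 1 -> eucl_norm b <= 1 ->
  eucl_norm ((1 - s) *: a + s *: b) <= 1.
Proof.
rewrite !eucl_norm_le1 => /andP[s0 s1] a1 b1.
apply: (@le_trans _ _ ((1 - s) * \sum_(i < n) a ord0 i ^+ 2 +
                       s * \sum_(i < n) b ord0 i ^+ 2)).
  rewrite !mulr_sumr -big_split; apply: ler_sum => i _ /=; rewrite !mxE -subr_ge0.
  (* Convexity of the square, coordinate by coordinate. *)
  rewrite (_ : _ - _ = s * (1 - s) * (a ord0 i - b ord0 i) ^+ 2); last by ring.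
  by rewrite mulr_ge0 ?sqr_ge0// mulr_ge0// subr_ge0.
by nra.
Qed.

Definition interpolate (s : 'rV[R]_n -> R) g1 g2 : 'rV[R]_n -> 'rV[R]_n :=
  fun x => (1 - s x) *: g1 x + s x *: g2 x.

Lemma test_interpolate s g1 g2 : C1 s -> (forall x, 0 <= s x <= 1) ->
  test_field g1 -> test_field g2 -> test_field (interpolate s g1 g2).
Proof.
move=> s1 s01 [/C1c_fieldP[g11 [B1 gB1]] gle1] [/C1c_fieldP[g21 [B2 gB2]] gle2].
split; last by move=> x; exact: eucl_norm_convex.
apply/C1c_fieldP; split=> [i|].
  rewrite (_ : (fun _ => _) =
    (fun x => (1 - s x) * g1 x ord0 i + s x * g2 x ord0 i)).
    by apply: C1D; apply: C1M => //; apply: C1B => //; exact: C1_cst.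
  by apply/funext => x; rewrite !mxE.
exists (Num.max B1 B2) => x; rewrite gt_max => /andP[/gB1 h1 /gB2 h2].
by rewrite /interpolate h1 h2 !scaler0 addr0.
Qed.

Section smooth.
Variables (d : R) (u v : 'rV[R]_n -> R).
Hypotheses (d0 : 0 < d) (u1 : C1 u) (v1 : C1 v).

Let a x := softstep d (u x - v x).
Let eta x := softpos d (u x - v x).
Let uv1 : C1 (fun x => u x - v x). Proof. exact: C1B. Qed.

Let C1a : C1 a.
Proof.
by apply: (C1_comp (is_derive_softstep d0) _ uv1); exact: continuous_softstep'.
Qed.

Let C1eta : C1 eta.
Proof.
by apply: (C1_comp (is_derive_softpos d0) _ uv1); exact: continuous_softstep.
Qed.

Let derive_eta i x : 'D_(delta_mx ord0 i) eta x =
  a x * ('D_(delta_mx ord0 i) u x - 'D_(delta_mx ord0 i) v x).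
Proof.
have := is_derive_chain (is_derive_C1 i x uv1) (is_derive_softpos d0 (u x - v x)).
move=> [_]; rewrite -/(eta) => ->; congr (_ * _).
have := is_deriveB (is_derive_C1 i x u1) (is_derive_C1 i x v1).
by move=> [_].
Qed.

(** The functions m = u - eta and M = v + eta replace min(u, v) and max(u, v).
    With a the derivative of softpos at u - v, their gradients are
      grad m = (1 - a) grad u + a grad v,  grad M = a grad u + (1 - a) grad v.
    Hence pairing grad m with g1 and grad M with g2 gives the same result as
    pairing grad u and grad v with the two interpolated fields, and these are
    test fields because the unit ball is convex. *)
Lemma smooth_min_max_le p q g1 g2 :
  (forall g, test_field g -> \int[mu]_x (u x * divergence g x) <= p) ->
  (forall g, test_field g -> \int[mu]_x (v x * divergence g x) <= q) ->
  test_field g1 -> test_field g2 ->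
  \int[mu]_x ((u x - eta x) * divergence g1 x) +
  \int[mu]_x ((v x + eta x) * divergence g2 x) <= p + q.
Proof.
move=> up vq tg1 tg2.
have a01 x : 0 <= a x <= 1 by exact: softstep_itv.
have th1 := test_interpolate C1a a01 tg1 tg2.
have th2 := test_interpolate C1a a01 tg2 tg1.
apply: le_trans (lerD (up _ th1) (vq _ th2)).
have m1 : C1 (fun x => u x - eta x) by exact: C1B.
have M1 : C1 (fun x => v x + eta x) by exact: C1D.
have [c1 c2] := (tg1.1, tg2.1); have [k1 k2] := (th1.1, th2.1).
rewrite !integration_by_parts_div// -!opprD -!intD; try exact: bbs_gradM_field.
rewrite le_eqVlt; apply/orP; left; apply/eqP; congr (- _).
apply: eq_Rintegral => x _; rewrite -!big_split/=; apply: eq_bigr => i _.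
have -> : 'D_(delta_mx ord0 i) (fun x => u x - eta x) x =
    'D_(delta_mx ord0 i) u x - 'D_(delta_mx ord0 i) eta x.
  by have [_] := is_deriveB (is_derive_C1 i x u1) (is_derive_C1 i x C1eta).
have -> : 'D_(delta_mx ord0 i) (fun x => v x + eta x) x =
    'D_(delta_mx ord0 i) v x + 'D_(delta_mx ord0 i) eta x.
  by have [_] := is_deriveD (is_derive_C1 i x v1) (is_derive_C1 i x C1eta).
rewrite derive_eta /interpolate !mxE; ring.
Qed.

End smooth.

Lemma max0_lipschitz (t t' : R) :
  `|Num.max t 0 - Num.max t' 0| <= `|t - t'|.
Proof.
have := ler_norm (t - t'); have := ler_norm (t' - t); rewrite (distrC t').
rewrite !maxEle ler_norml.
by case: (leP t 0) => h1; case: (leP t' 0) => h2 h3 h4; apply/andP; split; lra.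
Qed.

Lemma int_perturbation (f m h U : 'rV[R]_n -> R) (G e : R) :
  bbs (fun x => f x * h x) -> bbs (fun x => m x * h x) -> bbs h -> bbs U ->
  (forall x, `|h x| <= G) -> (forall x, 0 <= U x) ->
  (forall x, `|m x - f x| <= U x + e) ->
  \int[mu]_x (f x * h x) <=
  \int[mu]_x (m x * h x) + (G * \int[mu]_x U x + e * \int[mu]_x `|h x|).
Proof.
move=> bf bm bh bU hG U0 mf.
have bh' := bbs_norm bh.
have bGU : bbs (fun x => G * U x) := bbsZ G bU.
have beh : bbs (fun x => e * `|h x|) := bbsZ e bh'.
have bD : bbs (fun x => G * U x + e * `|h x|) := bbsD bGU beh.
rewrite -!intZ// -intD// -intD//; apply: le_int => //; first exact: bbsD.
move=> x; rewrite -lerBlDl -mulrBl.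
apply: le_trans (ler_norm _) _; rewrite normrM distrC.
apply: (@le_trans _ _ ((U x + e) * `|h x|)); first by rewrite ler_wpM2r.
by rewrite mulrDl lerD2r mulrC ler_wpM2r.
Qed.

(** Submodularity of the perimeter,
      P(E cap F) + P(E cup F) <= P(E) + P(F),
    tested on fields. The inequality for the mollified indicators and the
    smoothed minimum and maximum holds without error; undoing the two
    smoothings, both performed at the scale e, costs a multiple of e. *)
Lemma submodular_test E F (p q : R) g1 g2 :
  measurable E -> measurable F ->
  bbs (\1_E : 'rV[R]_n -> R) -> bbs (\1_F : 'rV[R]_n -> R) ->
  perimeter_bound E p -> perimeter_bound F q -> test_field g1 -> test_field g2 ->
  \int[mu]_x (\1_(E `&` F) x * divergence g1 x) +
  \int[mu]_x (\1_(E `|` F) x * divergence g2 x) <= p + q.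
Proof.
move=> mE mF bE bF Ep Fq tg1 tg2.
have b1 := bbs_divergence tg1.1; have b2 := bbs_divergence tg2.1.
have [_ [G1 gG1]] := b1; have [_ [G2 gG2]] := b2.
have G10 : 0 <= G1 by apply: le_trans (proj1 (gG1 0)).
have G20 : 0 <= G2 by apply: le_trans (proj1 (gG2 0)).
have p0 := perimeter_bound_ge0 Ep; have q0 := perimeter_bound_ge0 Fq.
(* The total error of the two smoothings at scale e is e K. *)
pose K : R := G1 * (2 * (p * n%:R) + q * n%:R) + \int[mu]_x `|divergence g1 x|
      + (G2 * (p * n%:R + 2 * (q * n%:R)) + \int[mu]_x `|divergence g2 x|).
have K0 : 0 <= K.
  have I1 : 0 <= \int[mu]_x `|divergence g1 x| by exact: int_ge0.
  have I2 : 0 <= \int[mu]_x `|divergence g2 x| by exact: int_ge0.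
  have pn : 0 <= p * n%:R by rewrite mulr_ge0.
  have qn : 0 <= q * n%:R by rewrite mulr_ge0.
  have h1 : 0 <= 2 * (p * n%:R) + q * n%:R.
    exact: (addr_ge0 (mulr_ge0 (ler0n R 2) pn) qn).
  have h2 : 0 <= p * n%:R + 2 * (q * n%:R).
    exact: (addr_ge0 pn (mulr_ge0 (ler0n R 2) qn)).
  exact: (addr_ge0 (addr_ge0 (mulr_ge0 G10 h1) I1) (addr_ge0 (mulr_ge0 G20 h2) I2)).
suff H e : 0 < e -> \int[mu]_x (\1_(E `&` F) x * divergence g1 x) +
    \int[mu]_x (\1_(E `|` F) x * divergence g2 x) <= p + q + e * K.
  apply/ler_addgt0Pr => e e0.
  have e'0 : 0 < e / (K + 1) by rewrite divr_gt0// ltr_wpDl.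
  apply: (le_trans (H _ e'0)); rewrite lerD2l mulrAC ler_pdivrMr ?ltr_wpDl//.
  by rewrite ler_wpM2l ?(ltW e0)// lerDl.
move=> e0; have [rho rhoP] := @mollifier_exists R n e e0.
pose u := corr \1_E rho; pose v := corr \1_F rho.
have u1 : C1 u := mollified_C1 rhoP bE.
have v1 : C1 v := mollified_C1 rhoP bF.
have bu : bbs u := bbs_mollified rhoP bE.
have bv : bbs v := bbs_mollified rhoP bF.
have udist := mollified_dist rhoP mE bE Ep.
have vdist := mollified_dist rhoP mF bF Fq.
rewrite -/u -/v in udist vdist.
have := smooth_min_max_le e0 u1 v1
  (fun g tg => mollified_perimeter_bound rhoP mE bE Ep tg)
  (fun g tg => mollified_perimeter_bound rhoP mF bF Fq tg) tg1 tg2.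
set eta := fun x => softpos e (u x - v x).
have ceta : continuous eta.
  apply: C1_continuous.
  apply: (C1_comp (is_derive_softpos e0) _ (C1B u1 v1)).
  exact: continuous_softstep.
have bdu : bbs (fun x => `|u x - \1_E x|) by apply: bbs_norm; exact: bbsB.
have bdv : bbs (fun x => `|v x - \1_F x|) by apply: bbs_norm; exact: bbsB.
have etad x : `|eta x - Num.max (\1_E x - \1_F x) 0| <=
    `|u x - \1_E x| + `|v x - \1_F x| + e.
  have h1 := softpos_dist e0 (u x - v x).
  apply: le_trans (ler_distD (Num.max (u x - v x) 0) _ _) _.
  rewrite addrC lerD//.
  apply: (@le_trans _ _ `|(u x - \1_E x) - (v x - \1_F x)|); last exact: ler_normB.
  set r := u x; set s := v x; set r' := \1_E x; set s' := \1_F x.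
  rewrite (_ : r - r' - (s - s') = (r - s) - (r' - s')); last by ring.
  exact: max0_lipschitz.
have max10 : Num.max (1 - 0) 0 = 1 :> R by rewrite subr0; exact/max_l/ler01.
have maxN0 : Num.max (0 - 1) 0 = 0 :> R by apply/max_r; lra.
have max11 : Num.max (1 - 1) 0 = 0 :> R by rewrite subrr maxxx.
have max00 : Num.max (0 - 0) 0 = 0 :> R by rewrite subrr maxxx.
have maxE := (max10, maxN0, max11, max00).
have IE x : \1_(E `&` F) x = \1_E x - Num.max (\1_E x - \1_F x) 0 :> R.
  rewrite !indicE in_setI; case: (x \in E); case: (x \in F) => /=;
    by rewrite !maxE !(subrr, subr0, sub0r, oppr0).
have UE x : \1_(E `|` F) x = \1_F x + Num.max (\1_E x - \1_F x) 0 :> R.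
  rewrite !indicE in_setU; case: (x \in E); case: (x \in F) => /=;
    by rewrite !maxE !(add0r, addr0).
pose U1 x := `|u x - \1_E x| + `|u x - \1_E x| + `|v x - \1_F x|.
pose U2 x := `|u x - \1_E x| + (`|v x - \1_F x| + `|v x - \1_F x|).
have bU1 : bbs U1 by apply: bbsD => //; exact: bbsD.
have bU2 : bbs U2 by apply: bbsD => //; exact: bbsD.
have intU1 : \int[mu]_x U1 x <= (2 * (p * n%:R) + q * n%:R) * e.
  by rewrite intD//; [rewrite intD//; lra|exact: bbsD].
have intU2 : \int[mu]_x U2 x <= (p * n%:R + 2 * (q * n%:R)) * e.
  by rewrite intD//; [rewrite intD//; lra|exact: bbsD].
have cu := C1_continuous u1; have cv := C1_continuous v1.
have H1 : \int[mu]_x (\1_(E `&` F) x * divergence g1 x) <=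
    \int[mu]_x ((u x - eta x) * divergence g1 x) +
    (G1 * \int[mu]_x U1 x + e * \int[mu]_x `|divergence g1 x|).
  apply: int_perturbation => //.
  - by apply: bbs_indicM => //; exact: measurableI.
  - apply: bbs_ctsM_div; last exact: tg1.1.
    by move=> x; exact: (continuousB (cu x) (ceta x)).
  - by move=> x; have [] := gG1 x.
  - by move=> x; rewrite !addr_ge0.
  - move=> x; rewrite IE.
    rewrite [X in `|X|](_ : _ = (u x - \1_E x) - (eta x - Num.max (\1_E x - \1_F x) 0)); last by ring.
    apply: le_trans (ler_normB _ _) _.
    by rewrite /U1 -!addrA lerD2l addrA; exact: etad.
have H2 : \int[mu]_x (\1_(E `|` F) x * divergence g2 x) <=
    \int[mu]_x ((v x + eta x) * divergence g2 x) +
    (G2 * \int[mu]_x U2 x + e * \int[mu]_x `|divergence g2 x|).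
  apply: int_perturbation => //.
  - by apply: bbs_indicM => //; exact: measurableU.
  - apply: bbs_ctsM_div; last exact: tg2.1.
    by move=> x; exact: (continuousD (cv x) (ceta x)).
  - by move=> x; have [] := gG2 x.
  - by move=> x; rewrite !addr_ge0.
  - move=> x; rewrite UE.
    rewrite [X in `|X|](_ : _ = (v x - \1_F x) + (eta x - Num.max (\1_E x - \1_F x) 0)); last by ring.
    apply: le_trans (ler_normD _ _) _.
    rewrite /U2 (addrC `|v x - _|) addrAC.
    apply: (@le_trans _ _ ((`|u x - \1_E x| + `|v x - \1_F x| + e) + `|v x - \1_F x|)).
      by rewrite lerD2r.
    lra.
have K1 := ler_wpM2l G10 intU1; have K2 := ler_wpM2l G20 intU2.
rewrite /K; move: H1 H2 K1 K2.
set i1 := \int[mu]_x (\1_(E `&` F) x * _); set i2 := \int[mu]_x (\1_(E `|` F) x * _).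
set j1 := \int[mu]_x ((u x - eta x) * _); set j2 := \int[mu]_x ((v x + eta x) * _).
set k1 := \int[mu]_x `|_|; set k2 := \int[mu]_x `|divergence g2 x|.
move=> H1 H2 K1 K2 H.
apply: (le_trans (lerD H1 H2)).
rewrite addrACA; apply: (lerD H).
rewrite mulrDr; apply: lerD; rewrite mulrDr; apply: (lerD _ (lexx _)).
  by rewrite mulrCA (mulrC e); exact: K1.
by rewrite mulrCA (mulrC e); exact: K2.
Qed.

End submodularity.
(** * Semicontinuity and a volume bound *)

Section l1_dist.
Context {R : realType} {n : nat}.
Local Notation mu := (lebesgue_rV n).
Implicit Types (A B E F : set 'rV[R]_n).

Definition l1_dist E F : R := \int[mu]_x `|\1_E x - \1_F x|.

Lemma bbs_indicS A B : measurable A -> A `<=` B ->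
  bbs (\1_B : 'rV[R]_n -> R) -> bbs (\1_A : 'rV[R]_n -> R).
Proof.
move=> mA AB bB; rewrite (_ : \1_A = fun x => \1_A x * \1_B x :> R).
  exact: bbs_indicM.
apply/funext => x; rewrite !indicE; case: (boolP (x \in A)) => [|_].
  by rewrite inE => /AB Bx; rewrite mem_set// mulr1.
by rewrite mul0r.
Qed.

Lemma measure_bbsE E : measurable E -> bbs (\1_E : 'rV[R]_n -> R) ->
  mu E = (\int[mu]_x \1_E x)%:E.
Proof. by move=> mE bE; rewrite EFin_int// integral_indic// setIT. Qed.

Lemma bbs_l1_dist E F : bbs (\1_E : 'rV[R]_n -> R) -> bbs (\1_F : 'rV[R]_n -> R) ->
  bbs (fun x => `|\1_E x - \1_F x| : R).
Proof. by move=> bE bF; apply: bbs_norm; exact: bbsB. Qed.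

Lemma l1_dist_measure E F : bbs (\1_E : 'rV[R]_n -> R) -> bbs (\1_F : 'rV[R]_n -> R) ->
  `|\int[mu]_x \1_E x - \int[mu]_x \1_F x| <= l1_dist E F.
Proof.
by move=> bE bF; rewrite -intB//; apply: norm_int_le; exact: bbsB.
Qed.

Lemma l1_dist_symdiff E F : bbs (\1_E : 'rV[R]_n -> R) -> bbs (\1_F : 'rV[R]_n -> R) ->
  measurable E -> measurable F ->
  (mu ((E `\` F) `|` (F `\` E)) = (l1_dist E F)%:E)%E.
Proof.
move=> bE bF mE mF; rewrite -(setIT (_ `|` _)) -integral_indic//; last first.
  by apply: measurableU; exact: measurableD.
rewrite /l1_dist EFin_int; last exact: bbs_l1_dist.
apply: eq_integral => x _; rewrite !indicE in_setU !in_setD.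
by case: (x \in E); case: (x \in F); rewrite /= ?subrr ?subr0 ?sub0r ?normrN ?normr0 ?normr1.
Qed.

Lemma int_divergence_dist E F (g : 'rV[R]_n -> 'rV[R]_n) (G : R) :
  measurable E -> measurable F ->
  bbs (\1_E : 'rV[R]_n -> R) -> bbs (\1_F : 'rV[R]_n -> R) ->
  C1c_field g -> (forall x, `|divergence g x| <= G) ->
  \int[mu]_x (\1_E x * divergence g x) <=
  \int[mu]_x (\1_F x * divergence g x) + G * l1_dist E F.
Proof.
move=> mE mF bE bF gc gG; have bg := bbs_divergence gc.
have b1 := bbs_indicM mE bg; have b2 := bbs_indicM mF bg.
have bd := bbs_l1_dist bE bF.
rewrite -intZ// -intD//; last exact: bbsZ.
apply: le_int => //; first by apply: bbsD => //; exact: bbsZ.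
move=> x; rewrite -lerBlDl -mulrBl; apply: le_trans (ler_norm _) _.
by rewrite normrM mulrC ler_wpM2r.
Qed.

(** Lower semicontinuity: each test field has a bounded divergence, so the
    quantity that it tests is continuous in E for the L1 distance. *)
Lemma perimeter_bound_lim (E_ : nat -> set 'rV[R]_n) E (p : R) :
  measurable E -> bbs (\1_E : 'rV[R]_n -> R) ->
  (forall k, measurable (E_ k)) -> (forall k, bbs (\1_(E_ k) : 'rV[R]_n -> R)) ->
  (forall e : R, 0 < e -> exists k, l1_dist E (E_ k) <= e /\ perimeter_bound (E_ k) (p + e)) ->
  perimeter_bound E p.
Proof.
move=> mE bE mE_ bE_ H g tg; have [_ [G gG]] := bbs_divergence tg.1.
have G0 : 0 <= G by apply: le_trans (proj1 (gG 0)).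
apply/ler_addgt0Pr => e e0.
have e'0 : 0 < e / (G + 1) by rewrite divr_gt0// ltr_wpDl.
have [k [dk Ek]] := H _ e'0.
have gG' x : `|divergence g x| <= G by have [] := gG x.
apply: le_trans (int_divergence_dist mE (mE_ k) bE (bE_ k) tg.1 gG') _.
have h1 := Ek _ tg; have h2 := ler_wpM2l G0 dk.
have h3 : G * (e / (G + 1)) + e / (G + 1) = e.
  by rewrite -[X in _ + X]mul1r -mulrDl mulrC divfK// gt_eqF// ltr_wpDl.
by rewrite -[X in _ <= _ + X]h3 addrCA addrC lerD.
Qed.

(** A weak form of the isoperimetric inequality. At a scale e of order 1 / l, the
    mollified indicator u of E differs from 1_E by at most half of the volume
    of E in L1. On the other hand u is at most K times this volume, where K
    bounds the mollifier, so u is far below 1 on E when E is small. *)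
Lemma lower_mass (l : R) : 0 <= l -> exists c : R, 0 < c /\
  forall E, measurable E -> bbs (\1_E : 'rV[R]_n -> R) ->
    perimeter_bound E (l * \int[mu]_x \1_E x) -> 0 < \int[mu]_x \1_E x ->
    c <= \int[mu]_x \1_E x.
Proof.
move=> l0; have ln0 : 0 <= l * n%:R by rewrite mulr_ge0.
(* At this scale the mollification error l n e |E| is at most |E| / 2. *)
pose e := (2 * (l * n%:R + 1))^-1.
have e0 : 0 < e by rewrite invr_gt0 mulr_gt0// ltr_wpDl.
have lne : l * n%:R * e <= 2^-1.
  by rewrite /e invfM mulrCA ler_piMr// ler_pdivrMr ?ltr_wpDl// mul1r lerDl.
have [rho rhoP] := @mollifier_exists R n e e0.
have [r1 r0 re _] := rhoP.
have [_ [K rK]] := bbs_cts (C1_continuous r1) re.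
have K0 : 0 <= K by apply: le_trans (proj1 (rK 0)).
have K10 : 0 < K + 1 by rewrite ltr_wpDl.
exists (2 * (K + 1))^-1; split; first by rewrite invr_gt0 mulr_gt0.
move=> E mE bE; set m := \int[mu]_x \1_E x => Ep m0.
have d := mollified_dist rhoP mE bE Ep.
set u := corr \1_E rho in d.
have uK x : u x <= (K + 1) * m.
  rewrite /m int_indic//; apply: (mollified_le_mass rhoP mE bE).
  move=> y; apply: le_trans (ler_norm _) _; apply: le_trans (proj1 (rK y)) _.
  by rewrite lerDl.
have : (1 - (K + 1) * m) * m <= 2^-1 * m.
  apply: (@le_trans _ _ (\int[mu]_x `|u x - \1_E x|)).
    rewrite -intZ//; apply: le_int; first exact: bbsZ.
      by apply: bbs_norm; apply: bbsB => //; exact: (bbs_mollified rhoP bE).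
    move=> x; rewrite indicE; case: (x \in E); last by rewrite mulr0.
    rewrite mulr1 distrC; apply: le_trans (ler_norm _).
    by rewrite lerD2l lerN2.
  apply: (le_trans d).
  rewrite (_ : _ * _ = (l * n%:R * e) * m); last by ring.
  by rewrite ler_wpM2r// ltW.
rewrite ler_pM2r// => h.
rewrite invfM ler_pdivrMr// mulrC; lra.
Qed.

End l1_dist.
(** * Compactness *)

Section ultralimits.
Context {R : realType}.

(** A bounded sequence of reals converges along every ultrafilter. *)
Lemma ultra_cauchy (U : set_system nat) (a : nat -> R) (e : R) :
  UltraFilter U -> (forall k, 0 <= a k <= 1) -> 0 < e ->
  exists S, U S /\ forall i j, S i -> S j -> `|a i - a j| <= e.
Proof.
move=> UU a01 e0; have UP := ultra_proper (UltraFilter := UU).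
have e20 : 0 < e / 2 by rewrite divr_gt0.
have a01U : (a @ U) `[0, 1]%classic.
  by apply: (@filterS _ U _ setT) filterT => k _; rewrite /= in_itv/=; exact: a01.
have [l [_ lc]] := @segment_compact R 0 1 (a @ U) _ a01U.
pose S := [set k | `|a k - l| < e / 2].
have [US|US] := in_ultra_setVsetC S UU.
  exists S; split=> // i j Si Sj; apply: le_trans (ler_distD l _ _) _.
  by rewrite (splitr e) lerD// ltW// distrC.
have aS : (a @ U) (a @` (~` S)) 
  by apply: (@filterS _ U _ (~` S)) US => k Sk; exists k.
have [x [[k Sk <-]]] := lc _ _ aS (nbhsx_ballx l _ e20).
by rewrite -ball_normE/= distrC => /Sk.
Qed.

End ultralimits.

Section compactness.
Context {R : realType} {n : nat}.
Local Notation mu := (lebesgue_rV n).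
Variables (E_ : nat -> set 'rV[R]_n) (Omega : set 'rV[R]_n) (C V : R).
Hypothesis mE : forall k, measurable (E_ k).
Hypothesis bE : forall k, bbs (\1_(E_ k) : 'rV[R]_n -> R).
Hypothesis EC : forall k, perimeter_bound (E_ k) C.
Hypothesis EV : forall k, \int[mu]_x \1_(E_ k) x <= V.
Hypothesis mO : measurable Omega.
Hypothesis bO : bounded_set Omega.
Hypothesis EO : forall k, \int[mu]_x \1_(E_ k `\` Omega) x <= k.+1%:R^-1 :> R.

Let bEO k : bbs (\1_(E_ k `\` Omega) : 'rV[R]_n -> R).
Proof. by apply: (bbs_indicS _ _ (bE k)); [exact: measurableD|exact: subIsetl]. Qed.

Let C0 : 0 <= C. Proof. exact: (perimeter_bound_ge0 (EC 0%N)). Qed.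

Let V0 : 0 <= V.
Proof. by apply: le_trans (EV 0%N); exact: int_ge0. Qed.

(** The argument of Arzela and Ascoli: the mollified indicators are Lipschitz with
    a common constant and Cauchy at each point along the ultrafilter, and
    compactness of the cube makes this uniform. *)
Lemma mollified_ultra_cauchy (U : set_system nat) rho (e : R) (M t : R) :
  UltraFilter U -> 0 < t -> mollifier e rho ->
  exists S, U S /\ forall i j, S i -> S j -> forall x, `|x| <= M ->
    `|corr \1_(E_ i) rho x - corr \1_(E_ j) rho x| <= t.
Proof.
move=> UU t0 rhoP; have UP := ultra_proper (UltraFilter := UU).
have [r1 r0 re _] := rhoP.
have [D [D0 DrD]] : exists D : R, 0 <= D /\
    forall x i, `|'D_(delta_mx ord0 i) rho x| <= D.
  have H i : exists D : R, 0 <= D /\ forall x, `|'D_(delta_mx ord0 i) rho x| <= D.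
    have [_ [D hD]] := bbs_derive i r1 re; exists D.
    by split=> [|x]; [apply: le_trans (proj1 (hD 0))|have [] := hD x].
  exists (\sum_i projT1 (cid (H i))); split.
    by apply: sumr_ge0 => i _; case: cid => ? [].
  move=> x i; rewrite (bigD1 i)//=; case: cid => Di [Di0 hDi] /=.
  apply: le_trans (hDi x) _; rewrite lerDl.
  by apply: sumr_ge0 => j _; case: cid => ? [].
have Lip := C1_lipschitz r1 DrD.
pose L := D * n%:R * V.
have L0 : 0 <= L by rewrite !mulr_ge0.
have uL k x x' : `|corr \1_(E_ k) rho x' - corr \1_(E_ k) rho x| <= L * `|x' - x|.
  apply: le_trans (mollified_lipschitz rhoP (mE k) (bE k) _ _ Lip) _.
  by rewrite ler_wpM2r// ler_wpM2l ?mulr_ge0// -int_indic.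
have H := (@compact_near_coveringP _ (@cube R n M)).1 (@compact_cube R n M).
have := H _ (filter_prod U U) (fun q x =>
   `|corr \1_(E_ q.1) rho x - corr \1_(E_ q.2) rho x| <= t) _.
case.
  move=> x _; have t30 : 0 < t / 3 by rewrite divr_gt0.
  have [S [US SS]] := ultra_cauchy UU (fun k => mollified_itv rhoP (bE k) x) t30.
  have d0 : 0 < t / 3 / (L + 1) by rewrite divr_gt0// ltr_wpDl.
  exists (ball x (t / 3 / (L + 1)), S `*` S).
    split => /=; first exact: nbhsx_ballx.
    by exists (S, S).
  move=> [x' [i j]] /= [xx' [Si Sj]].
  have xt : L * `|x' - x| <= t / 3.
    move: xx'; rewrite -ball_normE/= distrC => /ltW xx'.
    apply: (@le_trans _ _ ((L + 1) * `|x' - x|)).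
      by rewrite ler_wpM2r// lerDl.
    by rewrite mulrC -ler_pdivlMr// ltr_wpDl.
  have h1 := le_trans (uL i x x') xt.
  have h2 := le_trans (uL j x x') xt.
  have h3 := SS _ _ Si Sj.
  rewrite (_ : _ - _ = (corr \1_(E_ i) rho x' - corr \1_(E_ i) rho x)
     - (corr \1_(E_ j) rho x' - corr \1_(E_ j) rho x)
     + (corr \1_(E_ i) rho x - corr \1_(E_ j) rho x)); last by ring.
  apply: le_trans (ler_normD _ _) _.
  have h4 := ler_normB (corr \1_(E_ i) rho x' - corr \1_(E_ i) rho x)
    (corr \1_(E_ j) rho x' - corr \1_(E_ j) rho x).
  lra.
move=> [S1 S2] /= [US1 US2] S12; exists (S1 `&` S2).
split.
  by apply: (@filterI _ U) => //; exact: Uoo.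
move=> i j [Si _] [_ Sj] x xM; exact: (S12 (i, j)).
Qed.

(** On a cube that contains Omega, compare the indicators with their
    mollifications; off this cube only the parts of the sets outside Omega
    count, and they are small. *)
Lemma ultra_dist_cauchy (U : set_system nat) (e : R) : UltraFilter U ->
  (forall k, U [set i | (k <= i)%N]) -> 0 < e ->
  exists S, U S /\ forall i j, S i -> S j -> l1_dist (E_ i) (E_ j) <= e.
Proof.
move=> UU Uoo e0; have UP := ultra_proper (UltraFilter := UU).
have [M [M0 OM]] := bounded_subset_cube bO.
have Cn0 : 0 <= C * n%:R by rewrite mulr_ge0.
(* The distance is bounded by five terms: two mollification errors, the
   uniform distance of the mollifications, and the two parts outside Omega. *)
pose r := e / 5 / (C * n%:R + 1).
have r0 : 0 < r by rewrite !divr_gt0// ltr_wpDl.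
have rC : C * n%:R * r <= e / 5.
  have e5 : 0 <= e / 5 by rewrite divr_ge0// ltW.
  rewrite /r mulrCA; apply: ler_piMr => //.
  by rewrite ler_pdivrMr ?ltr_wpDl// mul1r lerDl.
have [rho rhoP] := @mollifier_exists R n r r0.
pose Q := cube M : set 'rV[R]_n.
have mQ : measurable Q by exact: measurable_norm_le.
have bQ : bbs (\1_Q : 'rV[R]_n -> R).
  apply: bbs_indic => //; exists M; split; first exact: num_real.
  by move=> N MN y /= yM; rewrite (le_trans yM)// ltW.
pose q := \int[mu]_x (\1_Q x : R).
have q0 : 0 <= q by apply: int_ge0.
pose t := e / 5 / (q + 1).
have t0 : 0 < t by rewrite !divr_gt0// ltr_wpDl.
have tq : t * q <= e / 5.
  have e5 : 0 <= e / 5 by rewrite divr_ge0// ltW.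
  by rewrite /t mulrAC ler_pdivrMr ?ltr_wpDl// ler_wpM2l// lerDl.
have [S [US SS]] := mollified_ultra_cauchy M UU t0 rhoP.
have e50 : 0 < e / 5 by rewrite divr_gt0.
pose N := Num.truncn (e / 5)^-1.
exists (S `&` [set i | (N <= i)%N]); split.
  by apply: (@filterI _ U) => //; exact: Uoo.
have small k : (N <= k)%N -> \int[mu]_x (\1_(E_ k `\` Omega) x : R) <= e / 5.
  move=> Nk; apply: le_trans (EO k) _.
  rewrite invf_ple ?posrE//; apply: ltW; apply: lt_le_trans (truncnS_gt _) _.
  by rewrite ler_nat ltnS.
move=> i j [Si Ni] [Sj Nj].
pose u k := corr \1_(E_ k) rho.
have bd k : bbs (fun x => `|u k x - \1_(E_ k) x|).
  by apply: bbs_norm; apply: bbsB => //; exact: (bbs_mollified rhoP (bE k)).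
have dk k : \int[mu]_x `|u k x - \1_(E_ k) x| <= e / 5.
  exact: le_trans (mollified_dist rhoP (mE k) (bE k) (EC k)) rC.
have btQ : bbs (fun x : 'rV[R]_n => t * \1_Q x : R) by exact: bbsZ.
pose D1 x := `|u i x - \1_(E_ i) x| + `|u j x - \1_(E_ j) x|.
pose D2 x : R := \1_(E_ i `\` Omega) x + \1_(E_ j `\` Omega) x.
have bD1 : bbs D1 by exact: bbsD.
have bD2 : bbs D2 by exact: bbsD.
have bD12 : bbs (fun x => D1 x + D2 x) by exact: bbsD.
apply: (@le_trans _ _ (\int[mu]_x (D1 x + D2 x + t * \1_Q x))).
  apply: le_int; [exact: bbs_l1_dist|exact: bbsD|].
  move=> x; rewrite /D1 /D2; have [xM|Mx] := leP `|x| M.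
    rewrite [\1_Q x]indicE mem_set// mulr1.
    rewrite (_ : _ - _ = (u i x - u j x) + (u j x - \1_(E_ j) x)
       - (u i x - \1_(E_ i) x)); last by ring.
    apply: le_trans (ler_normB _ _) _.
    have h1 := ler_normD (u i x - u j x) (u j x - \1_(E_ j) x).
    have h2 := SS _ _ Si Sj _ xM; rewrite -/(u i) -/(u j) in h2.
    have h3 : 0 <= \1_(E_ i `\` Omega) x :> R by [].
    have h4 : 0 <= \1_(E_ j `\` Omega) x :> R by [].
    lra.
  have nO : x \notin Omega.
    by apply/negP; rewrite inE => /OM; rewrite /cube/= leNgt Mx.
  have Z k : \1_(E_ k `\` Omega) x = \1_(E_ k) x :> R.
    by rewrite !indicE in_setD nO andbT.
  have h5 : 0 <= t * \1_Q x by rewrite mulr_ge0// ltW.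
  rewrite !Z; apply: le_trans (ler_normB _ _) _.
  rewrite (@ger0_norm _ (\1_(E_ i) x))// (@ger0_norm _ (\1_(E_ j) x))//.
  by rewrite -[leLHS]addr0 lerD// lerDr addr_ge0.
rewrite intD// intD// intD// intD// intZ// -/q.
have := dk i; have := dk j; have := small i Ni; have := small j Nj; move: tq.
rewrite -/q; lra.
Qed.

End compactness.
Section limit_set.
Context {R : realType} {n : nat}.
Local Notation mu := (lebesgue_rV n).
Implicit Types (A : nat -> set 'rV[R]_n).

(** A point that belongs to only one of A k and the upper limit enters or leaves
    the sequence at some index after k. *)
Lemma setY_limsup_sub A (k : nat) :
  A k `+` lim_sup_set A `<=` \bigcup_i (A (k + i)%N `+` A (k + i).+1).
Proof.
move=> x [[Akx nL]|[Lx nAkx]].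
  have [m [km nAm]] : exists m, (k <= m)%N /\ ~ A m x.
    apply: contrapT => /forallNP H; apply: nL => m _.
    exists (maxn k m) => /=; first exact: leq_maxr.
    by apply: contrapT => nA; apply: (H (maxn k m)); split => //; exact: leq_maxl.
  have [j [kj Aj nAj]] : exists j, [/\ (k <= j)%N, A j x & ~ A j.+1 x].
    apply: contrapT => /forallNP H.
    have : forall i, A (k + i)%N x.
      elim=> [|i IHi]; first by rewrite addn0.
      apply: contrapT; rewrite addnS => nAi; apply: (H (k + i)%N).
      by split => //; exact: leq_addr.
    by move=> /(_ (m - k)%N); rewrite subnKC.
  exists (j - k)%N => //; rewrite subnKC//; left; split => //.
have [m /= km Am] := Lx k I.
have [j [kj nAj Aj]] : exists j, [/\ (k <= j)%N, ~ A j x & A j.+1 x].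
  apply: contrapT => /forallNP H.
  have : forall i, ~ A (k + i)%N x.
    elim=> [|i IHi]; first by rewrite addn0.
    rewrite addnS => nAi; apply: (H (k + i)%N).
    by split => //; exact: leq_addr.
  by move=> /(_ (m - k)%N); rewrite subnKC.
by exists (j - k)%N => //; rewrite subnKC//; right; split.
Qed.

End limit_set.

Section compactness_theorem.
Context {R : realType} {n : nat}.
Local Notation mu := (lebesgue_rV n).
Variables (E_ : nat -> set 'rV[R]_n) (Omega : set 'rV[R]_n) (C V : R).
Hypothesis mE : forall k, measurable (E_ k).
Hypothesis bE : forall k, bbs (\1_(E_ k) : 'rV[R]_n -> R).
Hypothesis EC : forall k, perimeter_bound (E_ k) C.
Hypothesis EV : forall k, \int[mu]_x \1_(E_ k) x <= V.
Hypothesis mO : measurable Omega.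
Hypothesis bO : bounded_set Omega.
Hypothesis EO : forall k, \int[mu]_x \1_(E_ k `\` Omega) x <= k.+1%:R^-1 :> R.

(** Choose the k-th index in the intersection of the sets of indices on which the
    distances are below the k-th and the previous threshold: consecutive
    indices then share such a set. *)
Lemma fast_subsequence : exists s : nat -> nat, forall k,
  (k <= s k)%N /\ l1_dist (E_ (s k)) (E_ (s k.+1)) <= (2 ^+ k)^-1.
Proof.
have [U [UU Uoo]] := @ultraFilterLemma nat \oo _.
have UP := ultra_proper (UltraFilter := UU).
have Ule k : U [set i | (k <= i)%N] by apply: Uoo; exists k.
have H k : exists S, U S /\ forall i j, S i -> S j ->
    l1_dist (E_ i) (E_ j) <= (2 ^+ k)^-1.
  apply: (ultra_dist_cauchy mE bE EC EV mO bO EO UU Ule).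
  by rewrite invr_gt0 exprn_gt0.
pose S k := projT1 (cid (H k)).
have US k : U (S k) by rewrite /S; case: cid => T [UT HT].
have Sd k i j : S k i -> S k j -> l1_dist (E_ i) (E_ j) <= (2 ^+ k)^-1.
  by rewrite /S; case: cid => T [UT HT] /=; exact: HT.
have Sne k : (S k.-1 `&` (S k `&` [set i | (k <= i)%N])) !=set0.
  apply: (@filter_ex _ U); apply: (@filterI _ U); first exact: US.
  by apply: (@filterI _ U); [exact: US|exact: Ule].
exists (fun k => projT1 (cid (Sne k))) => k; split.
  by case: cid => i [? []].
apply: (Sd k); first by case: cid => i [? []].
by case: cid => i [].
Qed.

(** The upper limit of a fast subsequence, cut down to Omega, is its limit in
    L1: the symmetric differences of consecutive terms have a summable volume,
    and the parts outside Omega vanish in the limit. *)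
Lemma compactness : exists E, [/\ measurable E, E `<=` Omega &
  forall e : R, 0 < e -> exists k, l1_dist (E_ k) E <= e].
Proof.
have [s sP] := fast_subsequence.
pose L := lim_sup_set (fun k => E_ (s k)).
have mL : measurable L.
  apply: bigcapT_measurable => k; apply: bigcup_measurable => i _; exact: mE.
have mLO : measurable (L `&` Omega) by exact: measurableI.
have bLO : bbs (\1_(L `&` Omega) : 'rV[R]_n -> R).
  apply: (bbs_indicS mLO (@subIsetr _ _ _)); exact: bbs_indic.
have mY A B : measurable A -> measurable B -> measurable (A `+` B : set 'rV[R]_n).
  by move=> mA mB; rewrite setY_def; apply: measurableU; exact: measurableD.
exists (L `&` Omega); split => // e e0.
pose k := Num.truncn (e / 4)^-1.
have e40 : 0 < e / 4 by rewrite divr_gt0.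
have kT : k.+1%:R^-1 <= e / 4.
  by rewrite invf_ple ?posrE//; apply: ltW; exact: truncnS_gt.
have k2 : (2 ^+ k)^-1 <= e / 4.
  apply: le_trans kT; rewrite lef_pV2 ?posrE ?exprn_gt0//.
  by rewrite -natrX ler_nat ltn_expl.
exists (s k).
rewrite -lee_fin -l1_dist_symdiff//.
pose F i := E_ (s (k + i)%N) `+` E_ (s (k + i).+1).
have mF i : measurable (F i) by apply: mY.
have subF : (E_ (s k) `\` (L `&` Omega)) `|` ((L `&` Omega) `\` E_ (s k)) `<=`
    \bigcup_i F i `|` (E_ (s k) `\` Omega).
  move=> x [[Ex nLO]|[[Lx Ox] nE]].
    have [Ox|nOx] := pselect (Omega x); last by right.
    left; apply: (@setY_limsup_sub _ _ (fun k => E_ (s k)) k x).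
    by left; split => // Lx; apply: nLO.
  left; apply: (@setY_limsup_sub _ _ (fun k => E_ (s k)) k x).
  by right; split.
have muF i : (mu (F i) <= ((2 * (2 ^+ k)^-1) / (2 ^ i.+1)%:R)%:E)%E.
  rewrite /F setY_def l1_dist_symdiff// lee_fin; apply: le_trans (proj2 (sP (k + i)%N)) _.
  rewrite natrX exprS exprD le_eqVlt; apply/orP; left; apply/eqP; field.
  by rewrite !expf_neq0.
have mB : measurable (E_ (s k) `\` Omega) by exact: measurableD.
have mBF : measurable (\bigcup_i F i) by exact: bigcupT_measurable.
have -> : e = e / 2 + e / 2 by rewrite -splitr.
rewrite EFinD; apply: (@le_trans _ _ (mu (\bigcup_i F i) + mu (E_ (s k) `\` Omega))%E).
  apply: (@le_trans _ _ (mu (\bigcup_i F i `|` (E_ (s k) `\` Omega)))).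
    by apply: le_measure => //; rewrite inE; apply: measurableU => //; exact: measurableD.
  exact: measureU2.
apply: leeD.
  apply: (@le_trans _ _ (\sum_(0 <= i <oo) mu (F i))%E).
    exact: measure_sigma_subadditive.
  apply: (@le_trans _ _ (\sum_(0 <= i <oo) ((2 * (2 ^+ k)^-1) / (2 ^ i.+1)%:R)%:E)%E).
    by apply: lee_nneseries => // i _ _.
  apply: le_trans (epsilon_trick0 xpredT _) _; first by rewrite mulr_ge0.
  by rewrite lee_fin; lra.
have bB : bbs (\1_(E_ (s k) `\` Omega) : 'rV[R]_n -> R).
  exact: (bbs_indicS mB (@subIsetl _ _ _) (bE _)).
rewrite measure_bbsE// lee_fin; apply: le_trans (EO _) _.
apply: (@le_trans _ _ (e / 4)); last lra.
apply: le_trans kT; rewrite lef_pV2 ?posrE// ler_nat ltnS.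
by have [] := sP k.
Qed.

End compactness_theorem.
(** * The Cheeger constant *)

Section liminf.
Context {R : realType}.
Implicit Types (u : (\bar R)^nat) (a : \bar R).

Lemma limn_einfE u : limn_einf u = ereal_sup (range (einfs u)).
Proof. by rewrite limn_einf_lim; apply/cvg_lim => //; exact: cvg_einfs_sup. Qed.

Lemma lt_limn_einf u a : (a < limn_einf u)%E ->
  exists N, forall j, (N <= j)%N -> (a < u j)%E.
Proof.
rewrite limn_einfE => /ereal_sup_gt[_ [N _ <-] aN]; exists N => j Nj.
by apply: (lt_le_trans aN); apply: ereal_inf_lbound; exists j.
Qed.

Lemma limn_einf_lt u a : (limn_einf u < a)%E ->
  forall N, exists2 j, (N <= j)%N & (u j < a)%E.
Proof.
rewrite limn_einfE => ua N.
have : (einfs u N < a)%E.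
  by apply: le_lt_trans ua; apply: ereal_sup_ubound; exists N.
by move=> /ereal_inf_lt[_ [j /= Nj <-] uj]; exists j.
Qed.

End liminf.

Section cheeger.
Context {R : realType} {n : nat}.
Local Notation mu := (lebesgue_rV n).
Local Notation h := (@cheeger_constant R n).
Implicit Types (E F Omega : set 'rV[R]_n).

Lemma bbs_sub_bounded F Omega : measurable F -> F `<=` Omega ->
  bounded_set Omega -> bbs (\1_F : 'rV[R]_n -> R).
Proof.
move=> mF FO [M [Mr OM]]; apply: bbs_indic => //; exists M; split => //.
by move=> N MN x /FO /(OM _ MN).
Qed.

Lemma cheeger_le Omega F (l : R) : measurable F -> F `<=` Omega ->
  bounded_set Omega -> 0 < \int[mu]_x (\1_F x : R) ->
  perimeter_bound F (l * \int[mu]_x (\1_F x : R)) -> (h Omega <= l%:E)%E.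
Proof.
move=> mF FO bO m0 Fp; have bF := bbs_sub_bounded mF FO bO.
have mFE := measure_bbsE mF bF.
apply: (@le_trans _ _ (perimeter F / mu F)%E).
  apply: ereal_inf_lbound; exists F => //; split => //.
  by rewrite mFE lte_fin.
rewrite mFE inver gt_eqF// lee_pdivrMr// -EFinM.
exact/(perimeter_leP _ mF).
Qed.

Lemma cheeger_lt Omega (l : R) : bounded_set Omega -> (h Omega < l%:E)%E ->
  exists F, [/\ measurable F, F `<=` Omega, 0 < \int[mu]_x (\1_F x : R) &
    perimeter_bound F (l * \int[mu]_x (\1_F x : R))].
Proof.
move=> bO /ereal_inf_lt[_ [F [mF FO F0] <-]].
have bF := bbs_sub_bounded mF FO bO.
have mFE := measure_bbsE mF bF.
move: F0; rewrite mFE lte_fin => F0; rewrite inver gt_eqF// lte_pdivrMr// -EFinM => Fl.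
by exists F; split => //; apply/perimeter_leP => //; exact: ltW.
Qed.

Lemma cheeger_ge0 Omega : (0 <= h Omega)%E.
Proof.
apply: le_ereal_inf_tmp => _ [F [mF FO F0] <-].
apply: mule_ge0; first exact: perimeter_ge0.
by rewrite inve_ge0 ltW.
Qed.

Variables (Omega : set 'rV[R]_n) (Omega_ : nat -> set 'rV[R]_n).
Hypothesis mO : measurable Omega.
Hypothesis mO_ : forall j, measurable (Omega_ j).
Hypothesis bO : bounded_set Omega.
Hypothesis bO_ : forall j, bounded_set (Omega_ j).
Hypothesis cvgO : l1_dist (Omega_ j) Omega @[j --> \oo] --> 0.

Let bbO : bbs (\1_Omega : 'rV[R]_n -> R).
Proof. exact: bbs_indic. Qed.
Let bbO_ j : bbs (\1_(Omega_ j) : 'rV[R]_n -> R).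
Proof. exact: bbs_indic. Qed.

Let near_dist (e : R) : 0 < e ->
  exists N, forall j, (N <= j)%N -> l1_dist (Omega_ j) Omega <= e.
Proof.
move=> e0; have /cvgrPdist_le/(_ _ e0)[N _ HN] := cvgO.
exists N => j Nj; have := HN j Nj; rewrite /= sub0r normrN.
by apply: le_trans; exact: ler_norm.
Qed.

(** Almost optimal competitors for the sets of a subsequence converge to a set
    contained in Omega. Its volume is positive by lower_mass, and the bound
    on the ratio of perimeter to volume survives by semicontinuity. *)
Lemma cheeger_liminf_le (l : R) :
  (limn_einf (fun j => h (Omega_ j)) < l%:E)%E -> (h Omega <= l%:E)%E.
Proof.
move=> liml.
have H k : exists F, [/\ measurable F, bbs (\1_F : 'rV[R]_n -> R),
    0 < \int[mu]_x (\1_F x : R) /\ perimeter_bound F (l * \int[mu]_x (\1_F x : R)),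
    \int[mu]_x (\1_F x : R) <= \int[mu]_x (\1_Omega x : R) + 1 &
    \int[mu]_x (\1_(F `\` Omega) x : R) <= k.+1%:R^-1].
  have k0 : 0 < k.+1%:R^-1 :> R by rewrite invr_gt0.
  have [N HN] := near_dist k0.
  have [j Nj hj] := limn_einf_lt liml N.
  have [F [mF FO F0 Fl]] := cheeger_lt (bO_ j) hj.
  have bF := bbs_sub_bounded mF FO (bO_ j).
  have dj := HN j Nj.
  have bd : bbs (fun x => `|\1_(Omega_ j) x - \1_Omega x| : R) by exact: bbs_l1_dist.
  exists F; split => //.
    apply: (@le_trans _ _ (\int[mu]_x (\1_Omega x : R) + l1_dist (Omega_ j) Omega)).
      rewrite -intD//; apply: le_int => //; first exact: bbsD.
      move=> x; rewrite -lerBlDl; apply: le_trans (ler_norm _).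
      rewrite lerD2r !indicE ler_nat; case: (boolP (x \in F)) => //.
      by rewrite inE => /FO Ox; rewrite mem_set.
    by rewrite lerD2l (le_trans dj)// invf_le1// ler1n.
  apply: le_trans dj; apply: le_int => //.
    exact: (bbs_indicS (measurableD mF mO) (@subIsetl _ _ _) bF).
  move=> x; rewrite !indicE in_setD; case: (boolP (x \in F)) => //= [|_].
    rewrite inE => /FO Ox; rewrite (mem_set Ox).
    by case: (x \in Omega) => /=; rewrite ?mulr0n ?subr0 ?normr1 ?normr_ge0.
  exact: normr_ge0.
have l0 : 0 <= l.
  have [F [mF bF [F0 Fl] _ _]] := H 0%N.
  by have := perimeter_bound_ge0 Fl; rewrite pmulr_lge0.
pose F k := projT1 (cid (H k)).
have FP k : [/\ measurable (F k), bbs (\1_(F k) : 'rV[R]_n -> R),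
    0 < \int[mu]_x (\1_(F k) x : R) /\ perimeter_bound (F k) (l * \int[mu]_x (\1_(F k) x : R)),
    \int[mu]_x (\1_(F k) x : R) <= \int[mu]_x (\1_Omega x : R) + 1 &
    \int[mu]_x (\1_(F k `\` Omega) x : R) <= k.+1%:R^-1].
  by rewrite /F; case: cid.
have mF k : measurable (F k) by have [] := FP k.
have bF k : bbs (\1_(F k) : 'rV[R]_n -> R) by have [] := FP k.
have FV k : \int[mu]_x (\1_(F k) x : R) <= \int[mu]_x (\1_Omega x : R) + 1.
  by have [] := FP k.
have FO k : \int[mu]_x (\1_(F k `\` Omega) x : R) <= k.+1%:R^-1.
  by have [] := FP k.
have Fl k : perimeter_bound (F k) (l * \int[mu]_x (\1_(F k) x : R)) by have [_ _ []] := FP k.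
have F0 k : 0 < \int[mu]_x (\1_(F k) x : R) by have [_ _ []] := FP k.
have FC k : perimeter_bound (F k) (l * (\int[mu]_x (\1_Omega x : R) + 1)).
  by move=> g tg; apply: le_trans (Fl k g tg) _; rewrite ler_wpM2l.
have [E [mE EO Elim]] := compactness mF bF FC FV mO bO FO.
have bE := bbs_sub_bounded mE EO bO.
have [c [c0 cP]] := @lower_mass R n l l0.
have cF k : c <= \int[mu]_x (\1_(F k) x : R) by exact: cP.
have c20 : 0 < c / 2 by rewrite divr_gt0.
have E0 : 0 < \int[mu]_x (\1_E x : R).
  have [k dk] := Elim _ c20.
  have := l1_dist_measure (bF k) bE; have := cF k.
  by rewrite ler_norml => h1 /andP[_ h2]; lra.
apply: (cheeger_le mE EO bO E0).
apply: (perimeter_bound_lim mE bE mF bF) => e e0.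
have e'0 : 0 < e / (l + 1) by rewrite divr_gt0// ltr_wpDl.
have [k dk] := Elim _ e'0; exists k.
have dkE : l1_dist E (F k) = l1_dist (F k) E.
  by apply: eq_Rintegral => x _; rewrite distrC.
rewrite dkE; split.
  apply: (le_trans dk); rewrite ler_pdivrMr ?ltr_wpDl//.
  by rewrite ler_peMr ?(ltW e0)// lerDr.
move=> g tg; apply: le_trans (Fl k g tg) _.
have h1 : \int[mu]_x (\1_(F k) x : R) <= \int[mu]_x (\1_E x : R) + e / (l + 1).
  have := l1_dist_measure (bF k) bE.
  by rewrite ler_norml => /andP[_ h2]; lra.
apply: le_trans (ler_wpM2l l0 h1) _; rewrite mulrDr lerD2l.
by rewrite mulrCA ler_piMr ?(ltW e0)// ler_pdivrMr ?ltr_wpDl// mul1r lerDl.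
Qed.

Lemma cheeger_liminf : (h Omega <= limn_einf (fun j => h (Omega_ j)))%E.
Proof.
rewrite leNgt; apply/negP => lt1.
have [l l1 l2] : exists2 l : R, (limn_einf (fun j => h (Omega_ j)) < l%:E)%E &
    (l%:E < h Omega)%E.
  move: lt1; case: (limn_einf _) => [r| |].
  - case: (h Omega) => [s| |].
    + rewrite lte_fin => rs; exists ((r + s) / 2); rewrite lte_fin; lra.
    + by move=> _; exists (r + 1); rewrite ?ltry// lte_fin; lra.
    + by [].
  - by case: (h Omega).
  - move: (cheeger_ge0 Omega); case: (h Omega) => [s| |].
    + by move=> _ _; exists (s - 1); rewrite ?ltNyr// lte_fin; lra.
    + by move=> _ _; exists 0; rewrite ?ltNyr ?ltry.
    + by [].
by have := cheeger_liminf_le l1; rewrite leNgt l2.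
Qed.

Hypothesis fO : finite_perimeter Omega.
Hypothesis fO_ : forall j, finite_perimeter (Omega_ j).
Hypothesis cvgP : perimeter (Omega_ j) @[j --> \oo] --> perimeter Omega.

(** A competitor F for Omega yields the competitor F cap Omega_j for Omega_j. By
    submodularity its perimeter is at most
      P(F) + P(Omega_j) - P(F cup Omega_j),
    and a single test field that is almost optimal for Omega bounds the last
    term from below by nearly P(Omega), since F cup Omega_j tends to Omega. *)
Lemma cheeger_limsup (l l' : R) : (h Omega < l'%:E)%E -> l' < l ->
  exists N, forall j, (N <= j)%N -> (h (Omega_ j) <= l%:E)%E.
Proof.
move=> hl' ll'.
have arith (X Y Z r q q_ d lm l'm ld : R) : X + Y <= l'm + q_ -> q_ <= q + d ->
    q - d <= Z -> Z <= Y + r -> r <= d -> d * 3 + ld <= lm - l'm -> X <= lm - ld.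
  by lra.
have [F [mF FO m0 Fl]] := cheeger_lt bO hl'.
set m := \int[mu]_x (\1_F x : R) in m0 Fl.
have bF := bbs_sub_bounded mF FO bO.
have l'0 : 0 <= l' by have := perimeter_bound_ge0 Fl; rewrite pmulr_lge0.
have l0 : 0 < l by exact: le_lt_trans ll'.
have fin F' : measurable F' -> finite_perimeter F' ->
    exists q : R, perimeter F' = q%:E.
  move=> mF' fF'; exists (fine (perimeter F')); rewrite fineK//.
  by rewrite ge0_fin_numE//; exact: perimeter_ge0.
have [q Pq] := fin _ mO fO.
have q_P j : {q_ : R | perimeter (Omega_ j) = q_%:E}.
  by apply: cid; exact: fin.
(* A tolerance small enough for F cap Omega_j to keep a positive volume and for
   l' m + 3 d <= l (m - d). *)
pose d := Num.min (m / 2) ((l - l') * m / (3 + l)).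
have d0 : 0 < d.
  rewrite lt_min divr_gt0//= divr_gt0 ?mulr_gt0 ?subr_gt0//.
  by rewrite addr_gt0.
have dm : d <= m / 2 by rewrite ge_min lexx.
have dl : d * (3 + l) <= (l - l') * m.
  by rewrite -ler_pdivlMr ?addr_gt0// ge_min lexx orbT.
have [g2 tg2 g2q] : exists2 g, test_field g &
    q - d <= \int[mu]_x (\1_Omega x * divergence g x).
  have : ((q - d)%:E < perimeter Omega)%E by rewrite Pq lte_fin ltrBlDr ltrDl.
  move=> /ereal_sup_gt[_ [g [gc g1] <-]].
  rewrite integral_set_indic//; last exact: bbs_divergence.
  by rewrite lte_fin => /ltW; exists g.
have [_ [G gG]] := bbs_divergence tg2.1.
have G0 : 0 <= G by apply: le_trans (proj1 (gG 0)).
have e0 : 0 < Num.min d (d / (G + 1)).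
  by rewrite lt_min d0 divr_gt0// ltr_wpDl.
have [N1 HN1] := near_dist e0.
have [N2 HN2] : exists N, forall j, (N <= j)%N -> projT1 (q_P j) <= q + d.
  have qE : (fun j => (projT1 (q_P j))%:E) = (fun j => perimeter (Omega_ j)).
    by apply/funext => j; case: (q_P j).
  have : (fun j => (projT1 (q_P j))%:E) @ \oo --> q%:E by rewrite qE -Pq.
  move=> /fine_cvgP[_ /cvgrPdist_le/(_ _ d0)[N _ HN]]; exists N => j Nj.
  have := HN j Nj; rewrite /= distrC ler_norml => /andP[_]; lra.
exists (maxn N1 N2) => j; rewrite geq_max => /andP[/HN1 dj /HN2 qj].
have [dj1 dj2] : l1_dist (Omega_ j) Omega <= d /\ l1_dist (Omega_ j) Omega <= d / (G + 1).
  by move: dj; rewrite le_min => /andP.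
pose Fj := F `&` Omega_ j.
have mFj : measurable Fj by exact: measurableI.
have bFj := bbs_sub_bounded mFj (@subIsetr _ _ _) (bO_ j).
have bd : bbs (fun x => `|\1_(Omega_ j) x - \1_Omega x| : R) by exact: bbs_l1_dist.
have mj : m - d <= \int[mu]_x (\1_Fj x : R).
  rewrite lerBlDr; apply: (@le_trans _ _ (\int[mu]_x (\1_Fj x : R) + l1_dist (Omega_ j) Omega)).
    rewrite -intD//; apply: le_int => //; first exact: bbsD.
    move=> x; rewrite !indicE in_setI; case: (boolP (x \in F)) => [|_].
      rewrite inE => /FO Ox; rewrite (mem_set Ox).
      by case: (x \in Omega_ j); rewrite /= ?addr0 ?sub0r ?normrN ?normr1 ?add0r// lerDl.
    by rewrite /= add0r normr_ge0.
  by rewrite lerD2l.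
have Pj : perimeter_bound (Omega_ j) (projT1 (q_P j)).
  by apply/perimeter_leP => //; case: (q_P j) => ? /= ->.
have mU : measurable (F `|` Omega_ j) by exact: measurableU.
have bU : bbs (\1_(F `|` Omega_ j) : 'rV[R]_n -> R).
  have := bbsB (bbsD bF (bbO_ j)) bFj; congr bbs; apply/funext => x.
  rewrite !indicE in_setU in_setI.
  by case: (x \in F); case: (x \in Omega_ j); rewrite /= ?addr0 ?subr0 ?add0r ?addrK.
have dU : l1_dist Omega (F `|` Omega_ j) <= l1_dist (Omega_ j) Omega.
  apply: le_int => //; first exact: bbs_l1_dist.
  move=> x; rewrite !indicE in_setU distrC; case: (boolP (x \in F)) => //.
  by rewrite inE => /FO Ox; rewrite (mem_set Ox)/= subrr normr0.
have gG' x : `|divergence g2 x| <= G by have [] := gG x.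
have h2 := int_divergence_dist mO mU bbO bU tg2.1 gG'.
have h3 : G * l1_dist Omega (F `|` Omega_ j) <= d.
  apply: le_trans (ler_wpM2l G0 (le_trans dU dj2)) _.
  by rewrite mulrCA ler_piMr ?(ltW d0)// ler_pdivrMr ?ltr_wpDl// mul1r lerDl.
apply: (@cheeger_le _ Fj _ mFj (@subIsetr _ _ _) (bO_ j)).
  by apply: lt_le_trans mj; lra.
move=> g1 tg1.
have := submodular_test mF (mO_ j) bF (bbO_ j) Fl Pj tg1 tg2.
rewrite -/Fj.
have h4 : l * (m - d) <= l * \int[mu]_x (\1_Fj x : R) by rewrite ler_wpM2l// ltW.
move=> h5; apply: le_trans h4.
rewrite mulrBr; move: dl; rewrite mulrDr mulrBl (mulrC d l).
exact: arith h5 qj g2q h2 h3.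
Qed.

Lemma cheeger_cvg : h (Omega_ j) @[j --> \oo] --> h Omega.
Proof.
have liminf := cheeger_liminf.
have := cheeger_ge0 Omega; case E : (h Omega) => [r| |//] _.
  have up e : 0 < e -> exists N, forall j, (N <= j)%N -> (h (Omega_ j) <= (r + e)%:E)%E.
    move=> e0; apply: (@cheeger_limsup _ (r + e / 2)); last lra.
    by rewrite E lte_fin ltrDl divr_gt0.
  have lo e : 0 < e -> exists N, forall j, (N <= j)%N -> ((r - e)%:E < h (Omega_ j))%E.
    move=> e0; apply: lt_limn_einf; apply: lt_le_trans liminf.
    by rewrite E lte_fin ltrBlDr ltrDl.
  apply/fine_cvgP; split.
    have [N1 H1] := up 1 ltr01; have [N2 H2] := lo 1 ltr01.
    exists (maxn N1 N2) => // j /=; rewrite geq_max => /andP[/H1 h1 /H2 h2].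
    by rewrite fin_numE; move: h1 h2; case: (h (Omega_ j)).
  apply/cvgrPdist_le => e e0.
  have [N1 H1] := up e e0; have [N2 H2] := lo e e0.
  exists (maxn N1 N2) => // j /=; rewrite geq_max => /andP[/H1 h1 /H2 h2].
  move: h1 h2; case: (h (Omega_ j)) => [s| |] //=.
  rewrite lee_fin lte_fin => h1 h2; rewrite ler_norml; apply/andP; split; lra.
apply/cvgeyPge => A.
have [|N HN] := @lt_limn_einf _ (fun j => h (Omega_ j)) A%:E.
  by apply: lt_le_trans liminf; rewrite E ltry.
by exists N => // j /= /HN /ltW.
Qed.

End cheeger.

Local Open Scope ereal_scope.

Theorem theorem2p7 (R : realType) (n : nat) (hn : (2 <= n)%N)
  (Omega : set 'rV[R]_n) (Omega_ : nat -> set 'rV[R]_n)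
  (Omega_neq0 : Omega !=set0) (Omega_open : open Omega)
  (Omega_bounded : bounded_set Omega)
  (Omega_j_neq0 : forall j, Omega_ j !=set0)
  (Omega_j_open : forall j, open (Omega_ j))
  (Omega_j_bounded : forall j, bounded_set (Omega_ j))
  (cvg_L1 : 'N[lebesgue_rV n]_1[EFin \o (\1_(Omega_ j) \- \1_Omega)%R]
            @[j --> \oo] --> 0) :
  cheeger_constant Omega <= limn_einf (fun j => cheeger_constant (Omega_ j))
  /\
  (finite_perimeter Omega ->
   (forall j, finite_perimeter (Omega_ j)) ->
   perimeter (Omega_ j) @[j --> \oo] --> perimeter Omega ->
   cheeger_constant (Omega_ j) @[j --> \oo] --> cheeger_constant Omega).
Proof.
have mO := open_measurable_rV Omega_open.
have mO_ j := open_measurable_rV (Omega_j_open j).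
have cvgO : (l1_dist (Omega_ j) Omega @[j --> \oo] --> 0)%R.
  have : (l1_dist (Omega_ j) Omega)%:E @[j --> \oo] --> 0%:E.
    have distE : (fun j => (l1_dist (Omega_ j) Omega)%:E) =
        (fun j => 'N[lebesgue_rV n]_1[EFin \o (\1_(Omega_ j) \- \1_Omega)%R])%E.
      apply/funext => j; rewrite Lnorm1 /l1_dist EFin_int//.
      by apply: bbs_l1_dist; exact: bbs_indic.
    by rewrite distE.
  by move=> /fine_cvgP[].
split; first exact: cheeger_liminf.
by move=> fO fO_ cvgP; exact: cheeger_cvg.
Qed.
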